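(* Fix integers $N,k\ge1$ and complex variables $\mathbf x=(x_1,\ldots,x_N)$, $\mathbf r=(r_1,\ldots,r_N)$, $\mathbf w=(w_1,\ldots,w_k)$, $\boldsymbol\theta=(\theta_1,\ldots,\theta_k)$, $\mathbf y=(y_1,y_2,\ldots)$, $\mathbf s=(s_1,s_2,\ldots)$ satisfying $$\sup_{p\ge1}\left|\frac{s_p^{-2}y_p-x_i}{y_p-x_i}\,\frac{y_p-w_j}{s_p^{-2}y_p-w_j}\right|<1\qquad\text{for all }1\le i\le N,\ 1\le j\le k.$$ Then $$\sum_{\lambda=(\lambda_1\ge\ldots\ge\lambda_N\ge0)}G_\lambda(\mathbf w;\mathbf y;\boldsymbol\theta;\mathbf s)\,F_\lambda(\mathbf x;\mathbf y;\mathbf r;\mathbf s)=\frac{\prod_{1\le i\le j\le N}(r_i^{-2}x_i-x_j)\prod_{1\le i<j\le N}(s_i^{-2}y_i-y_j)}{\prod_{i,j=1}^N(y_i-x_j)}\prod_{i=1}^N\prod_{j=1}^k\frac{x_i-\theta_j^{-2}w_j}{x_i-w_j},$$ where the sum is over all signatures with $N$ parts.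
   Context: Signatures. A signature with $N$ parts is an integer sequence $\lambda=(\lambda_1\ge\ldots\ge\lambda_N\ge0)$; $\mathcal S(\lambda)=\{\lambda_j+N+1-j:1\le j\le N\}\subset\mathbb Z_{\ge1}$. Vertex weights. For $i_1,j_1,i_2,j_2\in\{0,1\}$ (numbers of paths entering from the bottom, entering from the left, exiting at the top, exiting to the right) put $W(\cdot)=W(\cdot\mid x;y;r;s)$ with $W(0,0;0,0)=1$, $W(1,1;1,1)=\frac{r^{-2}x-y}{s^{-2}y-x}$, $W(1,0;1,0)=\frac{s^{-2}y-r^{-2}x}{s^{-2}y-x}$, $W(0,1;0,1)=\frac{y-x}{s^{-2}y-x}$, $W(1,0;0,1)=\frac{x(r^{-2}-1)}{s^{-2}y-x}$, $W(0,1;1,0)=\frac{y(s^{-2}-1)}{s^{-2}y-x}$, and $W=0$ otherwise. Put $\widehat W(i_1,j_1;i_2,j_2)=W(i_1,j_1;i_2,j_2)/W(0,1;0,1)$. Partition functions. Let $\mathbf x=(x_1,\ldots,x_K)$, $\mathbf r=(r_1,\ldots,r_K)$, $\mathbf y=(y_1,y_2,\ldots)$, $\mathbf s=(s_1,s_2,\ldots)$. A configuration on $\mathbb Z_{\ge1}\times\{1,\ldots,K\}$ consists of vertical edge states $v(i,j)\in\{0,1\}$ ($i\ge1$, $0\le j\le K$; $v(i,j-1)$ is below and $v(i,j)$ above the vertex $(i,j)$) and horizontal edge states $h(i,j)\in\{0,1\}$ ($i\ge0$, $1\le j\le K$; $h(i-1,j)$ is to the left and $h(i,j)$ to the right of $(i,j)$).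 For $\lambda$ with $N$ parts (no relation between $N$ and $K$), $G_\lambda(\mathbf x;\mathbf y;\mathbf r;\mathbf s)$ is the sum over configurations with $v(i,0)=\mathbf 1_{1\le i\le N}$, $v(i,K)=\mathbf 1_{i\in\mathcal S(\lambda)}$, $h(0,j)=0$, and $h(i,j)=0$ for all large $i$, of $\prod_{i,j}W(v(i,j-1),h(i-1,j);v(i,j),h(i,j)\mid x_j;y_i;r_j;s_i)$. For $\lambda$ with $K$ parts, $F_\lambda(\mathbf x;\mathbf y;\mathbf r;\mathbf s)$ is the sum over configurations with $v(i,0)=\mathbf 1_{i\in\mathcal S(\lambda)}$, $v(i,K)=0$, $h(0,j)=0$, and $h(i,j)=1$ for all large $i$, of the same product with $\widehat W$ in place of $W$. Both sums have finitely many nonzero terms, and in each of them all but finitely many factors equal $1$. Parameters are assumed such that no denominator vanishes.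
   Formalization: Added hypotheses: if x_i=x_{i'} for some i≠i', then inf_p|y_p−x_i|>0; if w_j=w_{j'} for some j≠j', then inf_p|s_p^{-2}y_p−w_j|>0. Without them the series can diverge (N=1, k=2, w_1=w_2=w, y_p=w+e_p, s_p^{-2}y_p=w+2e_p, e_p→0 superexponentially). *)

(* Defs.v *)
From HB Require Import structures.
From mathcomp Require Import all_boot all_order all_algebra.
From mathcomp Require Import all_classical all_reals all_analysis.
From mathcomp Require Import finmap complex.
From mathcomp Require summability.

Set Implicit Arguments.
Unset Strict Implicit.
Unset Printing Implicit Defensive.

Import Order.TTheory GRing.Theory Num.Theory numFieldNormedType.Exports.
Local Open Scope classical_set_scope.
Local Open Scope ring_scope.

(* All indices are shifted to start at 0: [y p], [s p] stand for y_{p+1},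
   s_{p+1}, and the columns and the rows are numbered from 0. *)

Definition signature (N : nat) := {lam : N.-tuple nat | sorted geq lam}.

(* S(lam) = {lam_j + N + 1 - j : 1 <= j <= N}; both the part index j and the
   column lose 1 under the shift. *)
Definition part_set (N : nat) (lam : signature N) : pred nat :=
  [pred i | [exists j : 'I_N, i == (tnth (val lam) j + (N - j.+1))%N]].

Definition W (C : fieldType) (x y r s : C) (i1 j1 i2 j2 : bool) : C :=
  match i1, j1, i2, j2 with
  | false, false, false, false => 1
  | true, true, true, true => (r ^- 2 * x - y) / (s ^- 2 * y - x)
  | true, false, true, false =>
      (s ^- 2 * y - r ^- 2 * x) / (s ^- 2 * y - x)
  | false, true, false, true => (y - x) / (s ^- 2 * y - x)
  | true, false, false, true => x * (r ^- 2 - 1) / (s ^- 2 * y - x)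
  | false, true, true, false => y * (s ^- 2 - 1) / (s ^- 2 * y - x)
  | _, _, _, _ => 0
  end.

Definition What (C : fieldType) (x y r s : C) (i1 j1 i2 j2 : bool) : C :=
  W x y r s i1 j1 i2 j2 / W x y r s false true false true.

(* A pair (v, h).  [v i j], 0 <= j <= K, is the vertical edge of column i just
   below row j (so [v i ord0] is the bottom edge and [v i ord_max] the top
   edge); [h i j] is the horizontal edge of row j just to the left of column i
   (so [h 0 j] is the left boundary edge and [h i.+1 j] lies to the right of
   column i). *)
Definition config (K : nat) : Type :=
  ((nat -> 'I_K.+1 -> bool) * (nat -> 'I_K -> bool))%type.

Section Vertices.
Variables (K : nat) (c : config K).

Definition bot_edge (i : nat) (j : 'I_K) : bool :=
  c.1 i (widen_ord (leqnSn K) j).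
Definition top_edge (i : nat) (j : 'I_K) : bool := c.1 i (lift ord0 j).
Definition left_edge (i : nat) (j : 'I_K) : bool := c.2 i j.
Definition right_edge (i : nat) (j : 'I_K) : bool := c.2 i.+1 j.

(* Path conservation at every vertex.  A configuration violating it has a
   vertex of weight 0 and contributes nothing to a partition function.  Such
   configurations are discarded beforehand because they may have infinitely
   many factors different from 1, and the finitely supported product below
   would then be 1 by convention instead of 0. *)
Definition conserves_paths : Prop :=
  forall i j,
    (bot_edge i j + left_edge i j = top_edge i j + right_edge i j)%N.

Definition config_weight (C : fieldType)
    (wt : nat -> 'I_K -> bool -> bool -> bool -> bool -> C) : C :=
  \big[*%R/1%R]_(p \in [set: nat * 'I_K])
    wt p.1 p.2 (bot_edge p.1 p.2) (left_edge p.1 p.2)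
               (top_edge p.1 p.2) (right_edge p.1 p.2).

End Vertices.

Definition G_configs (K N : nat) (lam : signature N) : set (config K) :=
  [set c | [/\ conserves_paths c,
               forall i, c.1 i ord0 = (i < N)%N,
               forall i, c.1 i ord_max = part_set lam i,
               forall j, c.2 0%N j = false
             & exists M : nat, forall i j, (M <= i)%N -> c.2 i j = false]].

Definition F_configs (K : nat) (lam : signature K) : set (config K) :=
  [set c | [/\ conserves_paths c,
               forall i, c.1 i ord0 = part_set lam i,
               forall i, c.1 i ord_max = false,
               forall j, c.2 0%N j = false
             & exists M : nat, forall i j, (M <= i)%N -> c.2 i j = true]].

Definition G (C : fieldType) (K N : nat) (lam : signature N)
    (x : 'I_K -> C) (y : nat -> C) (r : 'I_K -> C) (s : nat -> C) : C :=
  \sum_(c \in @G_configs K N lam)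
    config_weight c (fun i j => W (x j) (y i) (r j) (s i)).

Definition F (C : fieldType) (K : nat) (lam : signature K)
    (x : 'I_K -> C) (y : nat -> C) (r : 'I_K -> C) (s : nat -> C) : C :=
  \sum_(c \in F_configs lam)
    config_weight c (fun i j => What (x j) (y i) (r j) (s i)).

(* Unconditional convergence of a countable family of complex numbers: the
   partial sums over finite sets of indices converge to [S].  [R[i]^o] is R[i]
   with the topology of its norm. *)
Definition has_sum (R : realType) (I : choiceType) (f : I -> R[i]) (S : R[i]) :
    Prop :=
  (summability.partial_sum f : {fset I} -> R[i]^o) @ summability.totally
    --> (S : R[i]^o).

(* In MathComp `|z| is itself an element of R[i], with zero imaginary part. *)
Definition cabs (R : realType) (z : R[i]) : R := complex.Re `|z|.

(* Main.v *)
(* The six-vertex weights are free-fermionic: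
     W(1,1;1,1) W(0,0;0,0) = W(0,1;1,0) W(1,0;0,1) - W(0,1;0,1) W(1,0;1,0),
   which is exactly what makes a row of vertices act on wedge products of
   vectors as the exterior power of its one-particle operator ([slater_row]).
   Stacking rows, every partition function becomes a determinant of one-particle
   amplitudes, and these are governed by an upper triangular matrix J with the
   row variables on its diagonal ([cascade]): with z_p = s_p^-2 y_p, a particle of
   F leaves column p with amplitude v phi_p(J),
     phi_p(X) = 1 / (y_p - X) prod_(t < p) (z_t - X) / (y_t - X).
   The sum of G F over the signatures with S(lambda) inside {0, ..., M - 1} is then a
   single N x N determinant.  The G-rows act on the row vectors v phi_p(J) as right
   multiplication by prod_j (J - theta_j^-2 w_j) / (J - w_j), up to a remainder that
   vanishes as M grows, because of the Sylvester equation solved by [Y].  Hence the product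
   formula, the factor det (v phi_p(J))_p being computed by elimination.
   Unconditional convergence follows from the determinants too: G F is bounded by a
   product over S(lambda) of one-particle amplitudes, and these decay geometrically:
   the transfer matrices (z_t - J_x) / (y_t - J_x) (x) (y_t - J_w) / (z_t - J_w) are
   triangular, with diagonal entries bounded by rho < 1 by hypothesis and
   off-diagonal entries that are uniformly bounded. *)

Require Import Defs.
From mathcomp Require Import all_boot all_order all_algebra.
From mathcomp Require Import all_classical all_reals all_analysis.
From mathcomp Require Import complex.
From mathcomp Require Import perm finmap.
From mathcomp Require Import ring zify.

Set Implicit Arguments.
Unset Strict Implicit.
Unset Printing Implicit Defensive.

Import Order.TTheory GRing.Theory Num.Theory numFieldNormedType.Exports.
Local Open Scope classical_set_scope.
Local Open Scope ring_scope.

(** * Transfer matrices and free fermions *)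

Section Chain.
Variables (C : comNzRingType) (T : finType).

Fixpoint chain n : ('I_n -> T -> T -> C) -> T -> T -> C :=
  match n with
  | 0 => fun _ a b => (a == b)%:R
  | n'.+1 => fun f a b =>
      \sum_t f ord0 a t * chain (fun i => f (lift ord0 i)) t b
  end.

Lemma eq_chain n (f g : 'I_n -> T -> T -> C) a b :
  (forall i a b, f i a b = g i a b) -> chain f a b = chain g a b.
Proof.
elim: n f g a => //= n IHn f g a efg.
by apply: eq_bigr => t _; rewrite efg (IHn _ (fun i => g (lift ord0 i))).
Qed.

Definition ffcons n (p : T * {ffun 'I_n -> T}) : {ffun 'I_n.+1 -> T} :=
  [ffun i => oapp p.2 p.1 (unlift ord0 i)].

Lemma ffcons0 n p : @ffcons n p ord0 = p.1.
Proof. by rewrite ffunE unlift_none. Qed.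

Lemma ffcons_lift n p i : @ffcons n p (lift ord0 i) = p.2 i.
Proof. by rewrite ffunE liftK. Qed.

Lemma ffcons_bij n : bijective (@ffcons n).
Proof.
exists (fun f : {ffun 'I_n.+1 -> T} => (f ord0, [ffun i => f (lift ord0 i)])).
  case=> t g; congr pair; first exact: ffcons0.
  by apply/ffunP => i; rewrite ffunE ffcons_lift.
move=> f; apply/ffunP => i; rewrite ffunE /=.
by case: unliftP => [j|] -> //=; rewrite ffunE.
Qed.

Lemma chainE n (f : 'I_n -> T -> T -> C) a b :
  chain f a b = \sum_(g : {ffun 'I_n.+1 -> T} |
                      (g ord0 == a) && (g ord_max == b))
    \prod_(i < n) f i (g (widen_ord (leqnSn n) i)) (g (lift ord0 i)).
Proof.
elim: n f a => [|n IHn] f a /=.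
  rewrite (eq_bigr (fun=> 1)) => [|g _]; last by rewrite big_ord0.
  have [<-|nab] := eqVneq a b; last first.
    rewrite big_pred0 // => g; rewrite (ord1 ord_max).
    by apply/negP => /andP[/eqP -> /eqP]; apply/eqP.
  rewrite (big_pred1 [ffun=> a]) // => g; rewrite (ord1 ord_max) andbb /=.
  by apply/eqP/eqP => [<-|-> //]; rewrite ?ffunE //; apply/ffunP => i; rewrite ffunE ord1.
transitivity (\sum_(g : {ffun 'I_n.+1 -> T} | g ord_max == b)
    f ord0 a (g ord0) * \prod_(i < n)
      f (lift ord0 i) (g (widen_ord (leqnSn n) i)) (g (lift ord0 i))).
  rewrite [RHS](partition_big (fun g : {ffun 'I_n.+1 -> T} => g ord0) xpredT) //=.
  apply: eq_bigr => t _; rewrite IHn mulr_sumr.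
  apply: eq_big => [g|g /andP[/eqP -> _] //]; exact: andbC.
rewrite (reindex (@ffcons n.+1)) /=; last first.
  by have [h hK Kh] := ffcons_bij n.+1; exists h => g _.
have maxE : ord_max = lift ord0 (ord_max : 'I_n.+1) by apply: val_inj.
transitivity (\sum_(p : T * {ffun 'I_n.+1 -> T} | (p.1 == a) && (p.2 ord_max == b))
    f ord0 a (p.2 ord0) * \prod_(i < n)
      f (lift ord0 i) (p.2 (widen_ord (leqnSn n) i)) (p.2 (lift ord0 i))).
  by rewrite -(pair_big_dep (fun t => t == a) (fun _ (g : {ffun _}) => g ord_max == b)
    (fun _ g => f ord0 a (g ord0) * \prod_(i < n)
      f (lift ord0 i) (g (widen_ord (leqnSn n) i)) (g (lift ord0 i)))) /= big_pred1_eq.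
apply: eq_big => [p|p /andP[/eqP pa _]]; first by rewrite ffcons0 maxE ffcons_lift.
rewrite big_ord_recl ffcons_lift; congr (f _ _ _ * _).
  by rewrite (_ : widen_ord _ _ = ord0) ?ffcons0 ?pa //; apply: val_inj.
apply: eq_bigr => i _; rewrite ffcons_lift; congr f.
by rewrite (_ : widen_ord _ _ = lift ord0 (widen_ord (leqnSn n) i)) ?ffcons_lift //; apply: val_inj.
Qed.

End Chain.

Lemma big_tuple_cons (R : nmodType) (T : finType) n (f : n.+1.-tuple T -> R) :
  \sum_t f t = \sum_a \sum_(t : n.-tuple T) f (cons_tuple a t).
Proof.
rewrite pair_big /= (reindex (fun p : T * n.-tuple T => cons_tuple p.1 p.2)) //=.
exists (fun t : n.+1.-tuple T => (thead t, behead_tuple t)) => [[a t] _|t _] /=.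
  by rewrite theadE; congr pair; apply: val_inj.
by apply: val_inj; rewrite /= [in RHS](tuple_eta t).
Qed.

Section Select.
Variable V : Type.

Fixpoint sel (A : nat -> V) (S : seq bool) : seq V :=
  if S is b :: S' then nseq b (A 0%N) ++ sel (A \o succn) S' else [::].

Lemma selE (A : nat -> V) (S : seq bool) :
  sel A S = [seq A i | i <- iota 0 (size S) & nth false S i].
Proof.
elim: S A => //= b S IHS A; rewrite {}IHS -[1%N]addn0 iotaDl filter_map.
case: b => /=; rewrite -map_comp; [congr cons|]; by apply: eq_map.
Qed.

End Select.

Section Slater.
Variables (C : fieldType) (V : lmodType C).

(* Stands for a linear functional on the exterior algebra of V: [D [:: v1; ..; vm]]
   is the value at the wedge product of the [vi], of any degree [m]. *)
Definition alternating (D : seq V -> C) :=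
  (forall pre post a u v,
     D (pre ++ (a *: u + v) :: post) = a * D (pre ++ u :: post) + D (pre ++ v :: post)) /\
  (forall pre post u, D (pre ++ u :: u :: post) = 0).

Lemma alternating_rcons D suf : alternating D -> alternating (fun vs => D (vs ++ suf)).
Proof. by case=> lD aD; split=> *; rewrite -!catA ?lD ?aD. Qed.

Lemma alternating0 D pre post : alternating D -> D (pre ++ 0 :: post) = 0.
Proof.
by case=> lD _; have:= lD pre post (-1) 0 0; rewrite scaler0 addr0 mulN1r addNr.
Qed.

Lemma alternatingZ D pre post a u : alternating D ->
  D (pre ++ (a *: u) :: post) = a * D (pre ++ u :: post).
Proof.
by move=> hD; rewrite -[a *: u]addr0 hD.1 alternating0 // addr0.
Qed.

Lemma alternatingC D pre post u v : alternating D ->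
  D (pre ++ u :: v :: post) = - D (pre ++ v :: u :: post).
Proof.
case=> lD aD; have := aD pre post (1 *: u + v); rewrite lD.
have lD' w : D (pre ++ w :: (1 *: u + v) :: post) =
    D (pre ++ w :: u :: post) + D (pre ++ w :: v :: post).
  by rewrite -cat_rcons lD !cat_rcons mul1r.
by rewrite !lD' !aD add0r addr0 mul1r => /eqP; rewrite addr_eq0 => /eqP.
Qed.

Definition rowZ (wt : nat -> bool -> bool -> bool -> bool -> C) M
    (S S' : M.-tuple bool) : bool -> bool -> C :=
  chain (fun (c : 'I_M) h h' => wt c (tnth S c) h (tnth S' c) h').

Lemma rowZ_cons wt M a a' (S S' : M.-tuple bool) h h' :
  rowZ wt (cons_tuple a S) (cons_tuple a' S') h h' =
  wt 0%N a h a' true * rowZ (fun c => wt c.+1) S S' true h' +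
  wt 0%N a h a' false * rowZ (fun c => wt c.+1) S S' false h'.
Proof.
rewrite /rowZ [LHS]/= big_bool /= !(tnth_nth a) /=.
congr (_ * _ + _ * _); apply: eq_chain => i b b'.
  by rewrite !(tnth_nth a).
by rewrite !(tnth_nth a).
Qed.

(* [e c] is the vector carried by a path that enters column [c] from the left, and
   [e M] the one of a path that leaves the strip on the right. *)
Lemma slater_row D (x r : C) M (y s : nat -> C) (A B U e : nat -> V) pre h
    (S : M.-tuple bool) :
  alternating D ->
  (forall c, (c < M)%N -> s c ^- 2 * y c - x != 0) ->
  (forall c, (c < M)%N -> (s c ^- 2 * y c - x) *: U c = A c - e c.+1) ->
  (forall c, (c < M)%N -> e c = e c.+1 + (s c ^- 2 * y c - y c) *: U c) ->
  (forall c, (c < M)%N -> B c = A c + (x * (1 - r ^- 2)) *: U c) ->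
  \sum_(S' : M.-tuple bool) \sum_(h' : bool)
    rowZ (fun c => W x (y c) r (s c)) S S' h h' *
      D (pre ++ sel A S' ++ nseq h' (e M)) =
  D (pre ++ nseq h (e 0%N) ++ sel B S).
Proof.
move=> hD; elim: M y s A B U e pre h S => [|M IHM] y s A B U e pre h S z0 hU he hB.
  rewrite (big_pred1 [tuple]) => [|S']; last by rewrite [S']tuple0; apply/esym/eqP.
  rewrite big_bool /rowZ /= !tuple0 /=.
  by case: h => /=; rewrite ?eqxx ?mul0r ?mul1r ?add0r ?addr0.
have {IHM} IH := IHM (y \o succn) (s \o succn) (A \o succn) (B \o succn) (U \o succn) (e \o succn)
  _ _ _ (fun c => z0 c.+1) (fun c => hU c.+1) (fun c => he c.+1) (fun c => hB c.+1).
rewrite big_tuple_cons.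
have -> : S = cons_tuple (thead S) (behead_tuple S).
  by apply: val_inj; rewrite /= [in LHS](tuple_eta S).
move: (thead S) (behead_tuple S) => {S} b S.
set Wc := fun c => W x (y c) r (s c).
transitivity (\sum_a \sum_(h0 : bool) Wc 0%N b h a h0 *
   D ((pre ++ nseq a (A 0%N)) ++ nseq h0 (e 1%N) ++ sel (B \o succn) S)).
  apply: eq_bigr => a _.
  under eq_bigr => S' _.
    under eq_bigr => h' _ do rewrite rowZ_cons mulrDl -!mulrA.
    rewrite big_split /= -!mulr_sumr.
    over.
  rewrite big_split /= -!mulr_sumr [RHS]big_bool.
  congr (_ * _ + _ * _).
    rewrite -(IH (pre ++ nseq a (A 0%N)) true); apply: eq_bigr => S' _.
    by apply: eq_bigr => h' _; rewrite !catA.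
  rewrite -(IH (pre ++ nseq a (A 0%N)) false); apply: eq_bigr => S' _.
  by apply: eq_bigr => h' _; rewrite !catA.
rewrite !big_bool {}/Wc /W.
have [[[{}z0 {}hU] {}he] {}hB] := (z0 0%N isT, hU 0%N isT, he 0%N isT, hB 0%N isT).
move: (s 0%N ^- 2) (r ^- 2) z0 hU he hB => s2 r2 z0 hU he hB.
set z := s2 * y 0%N in z0 hU he hB *.
have {}hU : U 0%N = (z - x)^-1 *: A 0%N - (z - x)^-1 *: e 1%N.
  by rewrite -scalerBr -hU scalerA mulVf // scale1r.
set T := sel (B \o succn) S; set E := e 1%N in hU he *; set A0 := A 0%N in hU hB *.
have eB : B 0%N = (1 + x * (1 - r2) / (z - x)) *: A0 + (- (x * (1 - r2) / (z - x))) *: E.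
  by rewrite hB hU scalerBr !scalerA scalerDl scale1r scaleNr addrA.
have ee : e 0%N = ((z - y 0%N) / (z - x)) *: A0 + (1 - (z - y 0%N) / (z - x)) *: E.
  by rewrite he hU scalerBr !scalerA scalerBl scale1r addrCA.
case: b; case: h => /=; rewrite ?cats0 /= ?mul0r ?add0r ?addr0 -?catA /=.
- have eD2 w : D (pre ++ w :: B 0%N :: T) =
      (1 + x * (1 - r2) / (z - x)) * D (pre ++ w :: A0 :: T) -
      (x * (1 - r2) / (z - x)) * D (pre ++ w :: E :: T).
    by rewrite eB -cat_rcons hD.1 alternatingZ // !cat_rcons mulNr.
  rewrite ee hD.1 alternatingZ // !eD2 !hD.2 (alternatingC _ _ E A0 hD).
  by rewrite /z; field; exact: z0.
- rewrite eB hD.1 alternatingZ //; congr (_ * _ + _ * _); rewrite /z; field; exact: z0.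
- rewrite ee hD.1 alternatingZ //; congr (_ * _ + _ * _); rewrite /z; field; exact: z0.
- by rewrite mul1r.
Qed.

Definition layers K (w theta : 'I_K -> C) (y s : nat -> C) M (out : 'I_K -> bool)
    (j : 'I_K) (S S' : M.-tuple bool) : C :=
  rowZ (fun c => W (w j) (y c) (theta j) (s c)) S S' false (out j).

Definition exits K (out : seq bool) (e : 'I_K -> V) : seq V :=
  rev (mask out [seq e j | j <- enum 'I_K]).

Lemma slater K D (w theta : 'I_K -> C) M (y s : nat -> C) (A B : nat -> V)
    (U E : nat -> 'I_K -> V) (S : M.-tuple bool) :
  alternating D ->
  (forall c j, (c < M)%N -> s c ^- 2 * y c - w j != 0) ->
  (forall c j, (c < M)%N -> (s c ^- 2 * y c - w j) *: U c j =
     A c + \sum_(l < K | (j < l)%N) (w l * (1 - theta l ^- 2)) *: U c l - E c.+1 j) ->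
  (forall c j, (c < M)%N -> E c j = E c.+1 j + (s c ^- 2 * y c - y c) *: U c j) ->
  (forall c, (c < M)%N -> B c = A c + \sum_l (w l * (1 - theta l ^- 2)) *: U c l) ->
  \sum_(out : K.-tuple bool) \sum_S'
    chain (layers w theta y s (tnth out)) S S' * D (sel A S' ++ exits out (E M)) =
  D (sel B S).
Proof.
elim: K D w theta B U E S => [|K IHK] D w theta B U E S hD z0 hU hE hB.
  rewrite (big_pred1 [tuple]) => [|S']; last by rewrite [S']tuple0; apply/esym/eqP.
  rewrite (bigD1 S) //= eqxx mul1r big1 ?addr0; last first.
    by move=> S' /negPf; rewrite eq_sym => ->; rewrite mul0r.
  rewrite /exits /= mask0s cats0 !selE; congr D; apply/eq_in_map => c.
  rewrite mem_filter mem_iota add0n size_tuple => /andP[_ cM].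
  by rewrite hB // big_ord0 addr0.
pose f0 := lift (ord0 : 'I_K.+1).
pose B' c := A c + \sum_l (w (f0 l) * (1 - theta (f0 l) ^- 2)) *: U c (f0 l).
pose D' (o : bool) vs := D (vs ++ nseq o (E M ord0)).
have IH o S1 := IHK (D' o) (w \o f0) (theta \o f0) B' (fun c j => U c (f0 j))
  (fun c j => E c (f0 j)) S1 (alternating_rcons _ hD) (fun c j => z0 c (f0 j)).
rewrite big_tuple_cons.
transitivity (\sum_(o : bool) \sum_S1
   rowZ (fun c => W (w ord0) (y c) (theta ord0) (s c)) S S1 false o * D' o (sel B' S1)).
  apply: eq_bigr => o _; under [RHS]eq_bigr => S1 _.
    rewrite -IH; [|by move=> c j cM; rewrite hU // big_mkcond big_ord_recl /= add0r -big_mkcond|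
      by move=> c j cM; rewrite hE|by []].
    rewrite mulr_sumr; over.
  rewrite [RHS]exchange_big /=; apply: eq_bigr => out _.
  under eq_bigr => S' _ do rewrite mulr_suml.
  under [RHS]eq_bigr => S1 _ do rewrite mulr_sumr.
  rewrite [LHS]exchange_big /=; apply: eq_bigr => S1 _; apply: eq_bigr => S' _.
  rewrite -mulrA /layers (tnth_nth o) /=; congr (_ * (_ * _)).
    by apply: eq_chain => j a b; rewrite (tnth_nth o) /= -tnth_nth.
  rewrite /D' -catA; congr (D (_ ++ _)).
  rewrite /exits enum_ordSl /= -map_comp.
  by case: (o); rewrite /= ?cats0 // rev_cons cats1.
rewrite exchange_big /=.
have := slater_row (x := w ord0) (r := theta ord0) (A := B') (B := B)
  (U := fun c => U c ord0) (e := fun c => E c ord0) [::] false S hD.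
apply => c cM; first exact: z0.
- by rewrite hU // big_mkcond big_ord_recl /= add0r.
- exact: hE.
- by rewrite hB // big_ord_recl /B' addrCA addrC.
Qed.

End Slater.

(** * Partition functions as products of transfer matrices *)

Section ConfigSum.
Variables (C : fieldType) (K M : nat).
Variable wt : nat -> 'I_K -> bool -> bool -> bool -> bool -> C.
Variables (hout : bool) (a b : nat -> bool).

Definition tuple_of_pred (a : nat -> bool) : M.-tuple bool :=
  [tuple a i | i < M].

Let data := ({ffun 'I_K.+1 -> M.-tuple bool} *
                    {ffun 'I_K -> {ffun 'I_M.+1 -> bool}})%type.

Let ext (d : data) : config K :=
  (fun i j => nth false (d.1 j) i,
   fun i j => if (i < M.+1)%N then d.2 j (inord i) else hout).

Let bdry (d : data) :=
  ((d.1 ord0 == tuple_of_pred a) && (d.1 ord_max == tuple_of_pred b)) &&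
  [forall j, (d.2 j ord0 == false) && (d.2 j ord_max == hout)].

Let cons (d : data) := [forall i : 'I_M, forall j,
  (bot_edge (ext d) i j + left_edge (ext d) i j ==
   top_edge (ext d) i j + right_edge (ext d) i j)%N].

Hypothesis wt0 : forall i j (p q p' q' : bool), (p + q)%N <> (p' + q')%N ->
  wt i j p q p' q' = 0.
Hypothesis wt1 : forall i j, (M <= i)%N -> wt i j false hout false hout = 1.
Hypothesis aM : forall i, (M <= i)%N -> a i = false.
Hypothesis bM : forall i, (M <= i)%N -> b i = false.

Let nth_tuple_of_pred (f : nat -> bool) i : (forall i, (M <= i)%N -> f i = false) ->
  nth false (tuple_of_pred f) i = f i.
Proof.
move=> fM; have [iM|Mi] := ltnP i M; last by rewrite nth_default ?size_tuple // fM.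
by rewrite -[i%N]/(val (Ordinal iM)) -tnth_nth tnth_mktuple.
Qed.

Let ext_v (d : data) i j : (M <= i)%N -> (ext d).1 i j = false.
Proof. by move=> Mi; rewrite /= nth_default // size_tuple. Qed.

Let ext_h (d : data) i j : bdry d -> (M <= i)%N -> (ext d).2 i j = hout.
Proof.
move=> /andP[_ /forallP/(_ j)/andP[_ /eqP dM]] Mi /=.
case: ltnP => // iM; rewrite -dM; congr (d.2 j _); apply: val_inj.
by rewrite /= inordK //; apply/eqP; rewrite eqn_leq -ltnS iM.
Qed.

Let ext_edges d (i : 'I_M) j :
  [/\ bot_edge (ext d) i j = tnth (d.1 (widen_ord (leqnSn K) j)) i,
      left_edge (ext d) i j = d.2 j (widen_ord (leqnSn M) i),
      top_edge (ext d) i j = tnth (d.1 (lift ord0 j)) i &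
      right_edge (ext d) i j = d.2 j (lift ord0 i)].
Proof.
rewrite /bot_edge /left_edge /top_edge /right_edge /= !ltnS ltn_ord.
rewrite (ltnW (ltn_ord i)) !(tnth_nth false); split=> //; congr (d.2 j _).
  by apply: val_inj; rewrite /= inordK // ltnS ltnW.
by apply: val_inj; rewrite /= inordK ?ltnS.
Qed.

Let ext_weight d : bdry d -> config_weight (ext d) wt =
  \prod_j \prod_(i < M) wt i j (tnth (d.1 (widen_ord (leqnSn K) j)) i)
    (d.2 j (widen_ord (leqnSn M) i)) (tnth (d.1 (lift ord0 j)) i)
    (d.2 j (lift ord0 i)).
Proof.
move=> bd; rewrite /config_weight.
pose r : seq (nat * 'I_K) := [seq (i, j) | i <- iota 0 M, j <- enum 'I_K].
have ur : uniq r.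
  by apply: allpairs_uniq; rewrite ?iota_uniq ?enum_uniq // => -[? ?] [? ?].
rewrite (fsbigE r) //; last first.
  move=> [i j] _ /negP ijr.
  have Mi : (M <= i)%N.
    rewrite leqNgt; apply/negP => iM; apply: ijr.
    by apply/allpairsP; exists (i, j); rewrite mem_iota mem_enum.
  have -> : bot_edge (ext d) i j = false by exact: ext_v.
  have -> : top_edge (ext d) i j = false by exact: ext_v.
  have -> : left_edge (ext d) i j = hout by exact: ext_h.
  have -> : right_edge (ext d) i j = hout by apply: ext_h => //; exact: leqW.
  exact: wt1.
rewrite big_mkcond /= (eq_bigr (fun p => wt p.1 p.2 (bot_edge (ext d) p.1 p.2)
  (left_edge (ext d) p.1 p.2) (top_edge (ext d) p.1 p.2) (right_edge (ext d) p.1 p.2))); last first.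
  by move=> p _; rewrite in_setT.
rewrite big_allpairs_dep exchange_big /= big_enum /=; apply: eq_bigr => j _.
have -> : iota 0 M = index_iota 0 M by rewrite /index_iota subn0.
rewrite big_mkord.
apply: eq_bigr => i _; by case: (ext_edges d i j) => <- <- <- <-.
Qed.

Lemma config_sum (CS : set (config K)) :
  (forall c, CS c <-> [/\ conserves_paths c, forall i, c.1 i ord0 = a i,
     forall i, c.1 i ord_max = b i, forall j, c.2 0%N j = false &
     forall i, (M <= i)%N -> (forall j, c.1 i j = false) /\ (forall j, c.2 i j = hout)]) ->
  \sum_(c \in CS) config_weight c wt =
  chain (fun j S S' => rowZ (fun i => wt i j) S S' false hout)
    (tuple_of_pred a) (tuple_of_pred b).
Proof.
move=> CSE.
transitivity (\sum_(d | bdry d && cons d) config_weight (ext d) wt).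
  rewrite (reindex_fsbig ext [set d | bdry d && cons d]).
    rewrite [RHS](bigfs _ (index_enum_uniq _)) //.
    by move=> d _; rewrite mem_index_enum.
  split.
  - move=> d /= /andP[bd /forallP cd]; apply/CSE.
    move: (bd) => /andP[/andP[/eqP d0 /eqP dK] /forallP dh]; split.
    + move=> i j; have [iM|Mi] := ltnP i M.
        by move: (forallP (cd (Ordinal iM)) j) => /eqP.
      have -> : bot_edge (ext d) i j = false by exact: ext_v.
      have -> : top_edge (ext d) i j = false by exact: ext_v.
      have -> : left_edge (ext d) i j = hout by exact: ext_h.
      by have -> : right_edge (ext d) i j = hout by apply: ext_h => //; exact: leqW.
    + by move=> i; rewrite /= d0 nth_tuple_of_pred //.
    + by move=> i; rewrite /= dK nth_tuple_of_pred //.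
    + move=> j /=; move: (dh j) => /andP[/eqP <- _]; congr (d.2 j _).
      by apply: val_inj; rewrite /= inordK.
    + by move=> i Mi; split=> j; [exact: ext_v|exact: ext_h].
  - move=> d d' /set_mem /= /andP[bd _] /set_mem /= /andP[bd' _] [ev eh].
    case: d d' bd bd' ev eh => [v h] [v' h'] bd bd' ev eh.
    congr pair; apply/ffunP => j.
      apply: eq_from_tnth => i; rewrite !(tnth_nth false).
      exact: (f_equal (fun u => u (i : nat) j) ev).
    apply/ffunP => i; have := f_equal (fun u => u (i : nat) j) eh.
    by rewrite /= ltn_ord inord_val.
  - move=> c /CSE [cc ca cb c0 cM].
    pose d : data := ([ffun j => [tuple c.1 i j | i < M]],
                      [ffun j => [ffun i : 'I_M.+1 => c.2 i j]]).
    have dc : ext d = c.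
      case: c @d cc ca cb c0 cM => cv ch d cc ca cb c0 cM; congr pair.
        apply/funext => i; apply/funext => j; rewrite ffunE.
        have [iM|Mi] := ltnP i M; last first.
          by rewrite nth_default ?size_tuple //; exact/esym/(cM i Mi).1.
        by rewrite -[i%N]/(val (Ordinal iM)) -tnth_nth tnth_mktuple.
      apply/funext => i; apply/funext => j; rewrite !ffunE.
      case: ltnP => iM; first by rewrite inordK.
      exact/esym/(cM i (ltnW iM)).2.
    exists d => //; apply/andP; split; last first.
      by apply/forallP => i; apply/forallP => j; rewrite dc; apply/eqP.
    rewrite /bdry; apply/andP; split.
      by apply/andP; split; apply/eqP/eq_from_tnth => i; rewrite ffunE !tnth_mktuple.
    by apply/forallP => j; rewrite !ffunE c0 (cM M _).2 // !eqxx.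
transitivity (\sum_(d | bdry d) config_weight (ext d) wt).
  rewrite big_mkcond [RHS]big_mkcond; apply: eq_bigr => d _.
  case: ifP => [/andP[-> _] //|]; case: ifP => //= bd /negbT.
  rewrite negb_forall => /existsP-[]i; rewrite negb_forall => /existsP[j] nc.
  rewrite ext_weight // (bigD1 j) //= (bigD1 i) //= wt0 ?mul0r //.
  by case: (ext_edges d i j) nc => -> -> -> -> /eqP.
rewrite (eq_bigr _ (fun d => @ext_weight d)).
rewrite chainE; under [RHS]eq_bigr => v _.
  under eq_bigr => j _ do rewrite /rowZ chainE.
  rewrite bigA_distr_big_dep.
  over.
rewrite pair_big_dep; apply: eq_bigl => -[v h]; rewrite /bdry /=.
by congr (_ && _); rewrite inE; apply/forallP/forallP.
Qed.
End ConfigSum.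

Lemma chainZ (C : comNzRingType) (T : finType) n (k : 'I_n -> C)
    (f : 'I_n -> T -> T -> C) a b :
  chain (fun i a b => k i * f i a b) a b = (\prod_i k i) * chain f a b.
Proof.
elim: n k f a => [|n IHn] k f a /=; first by rewrite big_ord0 mul1r.
rewrite big_ord_recl mulr_sumr; apply: eq_bigr => t _.
by rewrite (IHn (fun i => k (lift ord0 i))) mulrACA.
Qed.

Section PartitionFunctions.
Variables (C : fieldType) (K M : nat).

Lemma G_chain N (lam : signature N) (w theta : 'I_K -> C) (y s : nat -> C) :
  (N <= M)%N -> (forall i, part_set lam i -> (i < M)%N) ->
  G lam w y theta s =
  chain (layers w theta y s (fun=> false))
    (tuple_of_pred M (fun i => i < N)%N) (tuple_of_pred M (part_set lam)).
Proof.
move=> NM lamM.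
have partM i : (M <= i)%N -> part_set lam i = false.
  by rewrite leqNgt; apply: contraNF => /lamM.
rewrite /G (config_sum (hout := false) (a := fun i => (i < N)%N)
  (b := part_set lam) (M := M)) //.
- by move=> i j [] [] [] [].
- by move=> i Mi; apply/negbTE; rewrite -leqNgt (leq_trans NM).
move=> c; split=> [[cc ca cb c0 [L cL]]|[cc ca cb c0 cM]]; last first.
  by split=> //; exists M => i j Mi; rewrite (cM i Mi).2.
split=> //.
have hM j : (forall i, (M <= i)%N -> top_edge c i j = false) ->
    forall i, (M <= i)%N -> c.2 i j = false.
  move=> topj i Mi; have [d] : exists d, (L - i = d)%N by exists (L - i)%N.
  elim: d i Mi => [|d IHd] i Mi Ld; first by apply: cL; lia.
  have h1 : c.2 i.+1 j = false by apply: IHd; lia.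
  have := cc i j; rewrite topj // add0n /left_edge /right_edge h1.
  by case: (c.2 i j) => //; rewrite addn1.
have vM d : (d <= K)%N -> forall j : 'I_K.+1, (K - d <= j)%N ->
    forall i, (M <= i)%N -> c.1 i j = false.
  elim: d => [|d IHd] dK j jK i Mi.
    have -> : j = ord_max by apply: val_inj => /=; move: (ltn_ord j); lia.
    by rewrite cb partM.
  have [jl|jg] := leqP (K - d) j; first by apply: IHd => //; lia.
  have jK' : (j < K)%N by move: (ltn_ord j); lia.
  pose j' := Ordinal jK'.
  have topj k : (M <= k)%N -> top_edge c k j' = false.
    by move=> Mk; apply: IHd => //=; rewrite /bump /=; lia.
  have := cc i j'; rewrite topj // /left_edge /right_edge !(hM _ topj) //; last lia.
  rewrite /bot_edge (_ : widen_ord _ _ = j); last by apply: val_inj.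
  by case: (c.1 i j).
by move=> i Mi; split=> j; [apply: (vM K) => //; lia|apply: hM => // k Mk; apply: (vM K) => //; lia].
Qed.

Lemma F_chain (lam : signature K) (x r : 'I_K -> C) (y s : nat -> C) :
  (forall i, part_set lam i -> (i < M)%N) ->
  (forall p i, s p ^- 2 * y p - x i != 0) -> (forall p i, y p - x i != 0) ->
  F lam x y r s =
  (\prod_i \prod_(c < M) ((s c ^- 2 * y c - x i) / (y c - x i))) *
  chain (layers x r y s (fun=> true))
    (tuple_of_pred M (part_set lam)) (tuple_of_pred M (fun=> false)).
Proof.
move=> lamM zx yx.
have partM i : (M <= i)%N -> part_set lam i = false.
  by rewrite leqNgt; apply: contraNF => /lamM.
rewrite /F (config_sum (hout := true) (a := part_set lam) (b := fun=> false) (M := M)) //.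
- rewrite -chainZ; apply: eq_chain => j S S'.
  rewrite /layers /rowZ -chainZ; apply: eq_chain => i h h'.
  by rewrite /What mulrC /= invf_div.
- by move=> i j; case; case; case; case=> //= _; rewrite /What /= ?mul0r.
- by move=> i j _; rewrite /What divff //= mulf_neq0 // ?invr_neq0.
move=> c; split=> [[cc ca cb c0 [L cL]]|[cc ca cb c0 cM]]; last first.
  by split=> //; exists M => i j Mi; rewrite (cM i Mi).2.
split=> //.
have hM j : (forall i, (M <= i)%N -> bot_edge c i j = false) ->
    forall i, (M <= i)%N -> c.2 i j = true.
  move=> botj i Mi; have [d] : exists d, (L - i = d)%N by exists (L - i)%N.
  elim: d i Mi => [|d IHd] i Mi Ld; first by apply: cL; lia.
  have h1 : c.2 i.+1 j = true by apply: IHd; lia.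
  have := cc i j; rewrite botj // add0n /left_edge /right_edge h1.
  by case: (c.2 i j) => //; rewrite addn1.
have vM d : forall j : 'I_K.+1, (j <= d)%N ->
    forall i, (M <= i)%N -> c.1 i j = false.
  elim: d => [|d IHd] j jK i Mi.
    have -> : j = ord0 by apply: val_inj => /=; lia.
    by rewrite ca partM.
  have [jl|jg] := leqP j d; first by apply: IHd.
  have jK' : (j.-1 < K)%N by move: (ltn_ord j); lia.
  pose j' := Ordinal jK'.
  have botj k : (M <= k)%N -> bot_edge c k j' = false.
    by move=> Mk; apply: IHd => //=; lia.
  have := cc i j'; rewrite botj // /left_edge /right_edge !(hM _ botj) //; last lia.
  rewrite /top_edge (_ : lift _ _ = j); last by apply: val_inj; rewrite /= /bump /=; lia.
  by case: (c.1 i j).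
have vK (j : 'I_K.+1) i : (M <= i)%N -> c.1 i j = false.
  by apply: (vM K); rewrite -ltnS ltn_ord.
by move=> i Mi; split=> j; [exact: vK|apply: hM => // k Mk; exact: vK].
Qed.

End PartitionFunctions.

(** * One-particle amplitudes and determinantal formulas *)

Section RevDet.
Variables (C : fieldType) (n : nat).

(* The list is reversed so that the columns occupied by a signature, listed in
   increasing order, give the rows in the order of its parts. *)
Definition rdet (vs : seq 'rV[C]_n) : C :=
  if size vs == n then \det (\matrix_(i < n) nth 0 (rev vs) i) else 0.

Lemma rdet_size vs : size vs != n -> rdet vs = 0.
Proof. by rewrite /rdet => /negbTE ->. Qed.

Lemma alternating_rdet : alternating rdet.
Proof.
split=> [pre post a u v|pre post u]; rewrite /rdet !size_cat /=.
  case: eqP => [szn|_]; last by rewrite mulr0 addr0.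
  have pn : (size post < n)%N by apply: leq_trans (eq_leq szn); rewrite addnS ltnS leq_addl.
  have [f nthE] : exists f, forall w (i : 'I_n), nth 0 (rev (pre ++ w :: post)) i =
      if i == Ordinal pn then w else f i.
    exists (fun i : 'I_n => nth 0 (rev (pre ++ 0 :: post)) i) => w i.
    rewrite !rev_cat !rev_cons !cat_rcons !nth_cat size_rev -val_eqE /=.
    case: ltngtP => //= ip; last by rewrite ip subnn.
    by move: ip; rewrite -subn_gt0; case: (_ - _)%N.
  rewrite (@determinant_multilinear _ _ _ (\matrix_i nth 0 (rev (pre ++ u :: post)) i)
    (\matrix_i nth 0 (rev (pre ++ v :: post)) i) (Ordinal pn) a 1) ?mul1r //.
  - by rewrite !rowK !nthE eqxx scale1r.
  - by apply/matrixP => i j; rewrite !mxE !nthE eq_sym (negbTE (neq_lift _ _)).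
  - by apply/matrixP => i j; rewrite !mxE !nthE eq_sym (negbTE (neq_lift _ _)).
case: eqP => [szn|//].
have pn : (size post < n)%N by apply: leq_trans (eq_leq szn); rewrite !addnS ltnS leqW ?leq_addl.
have pn' : ((size post).+1 < n)%N by apply: leq_trans (eq_leq szn); rewrite !addnS !ltnS leq_addl.
apply: (determinant_alternate (i1 := Ordinal pn) (i2 := Ordinal pn')).
  by rewrite -val_eqE /=; lia.
move=> j; rewrite !mxE rev_cat !rev_cons !cat_rcons !nth_cat size_rev /=.
by rewrite ltnn subnn ltnNge leqnSn /= subSnn.
Qed.

End RevDet.

Section Cascade.
Variables (C : fieldType) (n : nat).

Definition jump (w theta : 'I_n -> C) : 'rV_n :=
  \row_j (w j * (1 - theta j ^- 2)).

Definition cascade (w theta : 'I_n -> C) : 'M[C]_n :=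
  \matrix_(i, j) (if i == j then w i else
                  if (i < j)%N then w j * (1 - theta j ^- 2) else 0).

Lemma cascade_mulE m (w theta : 'I_n -> C) (U : 'M[C]_(n, m)) j :
  row j (cascade w theta *m U) =
  w j *: row j U + \sum_(l < n | (j < l)%N) (w l * (1 - theta l ^- 2)) *: row l U.
Proof.
rewrite row_mul mulmx_sum_row (bigD1 j) //= !mxE eqxx; congr (_ + _).
rewrite big_mkcond [RHS]big_mkcond; apply: eq_bigr => l _; rewrite !mxE eq_sym.
by case: eqP => [->|_] /=; rewrite ?ltnn //; case: ifP; rewrite ?scale0r.
Qed.

Lemma det_cascade_sub a (w theta : 'I_n -> C) :
  \det (a%:M - cascade w theta) = \prod_i (a - w i).
Proof.
rewrite -det_tr det_trig; last first.
  by apply/is_trig_mxP => i j ij; rewrite !mxE -val_eqE gtn_eqF //= ltnNge ltnW //= subr0.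
by apply: eq_bigr => i _; rewrite !mxE eqxx mulr1n.
Qed.

Lemma unit_cascade_sub a (w theta : 'I_n -> C) :
  (a%:M - cascade w theta \in unitmx) = [forall i, a - w i != 0].
Proof.
rewrite unitmxE det_cascade_sub unitfE.
by apply/prodf_neq0/forallP => h i; [exact: h|move=> _; exact: h].
Qed.

End Cascade.

Section Resolvent.
Variables (C : fieldType) (n : nat) (J : 'M[C]_n).

Definition res (a : C) : 'M[C]_n := invmx (a%:M - J).

Lemma comm_mxV (A B : 'M[C]_n) : B \in unitmx -> comm_mx A B -> comm_mx A (invmx B).
Proof.
move=> uB cAB; rewrite /comm_mx -[A in LHS](mulKmx uB) -cAB.
by rewrite -!mulmxA mulmxV // mulmx1.
Qed.

Lemma comm_sub a b : comm_mx (a%:M - J) (b%:M - J).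
Proof.
apply: comm_mxB; first exact: comm_mx_scalar.
by apply/comm_mx_sym/comm_mxB; [exact: comm_mx_scalar|].
Qed.

Lemma comm_res a b : a%:M - J \in unitmx -> comm_mx (b%:M - J) (res a).
Proof. by move=> ua; apply: comm_mxV => //; exact: comm_sub. Qed.

Variables (y z : nat -> C).

Fixpoint pimx c : 'M[C]_n :=
  if c is c'.+1 then pimx c' *m ((z c')%:M - J) *m res (y c') else 1%:M.

Definition phimx c : 'M[C]_n := pimx c *m res (y c).

Lemma comm_pimx (A : 'M[C]_n) c : (forall p, (y p)%:M - J \in unitmx) ->
  comm_mx A J -> comm_mx A (pimx c).
Proof.
move=> uy AJ; have As a : comm_mx A (a%:M - J).
  by apply: comm_mxB => //; exact: comm_mx_scalar.
elim: c => //= [|c IHc]; first exact: comm_mx1.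
by do 2?[apply: comm_mxM => //]; apply: comm_mxV.
Qed.

Lemma comm_phimx (A : 'M[C]_n) c : (forall p, (y p)%:M - J \in unitmx) ->
  comm_mx A J -> comm_mx A (phimx c).
Proof.
move=> uy AJ; apply: comm_mxM; first exact: comm_pimx.
by apply: comm_mxV => //; apply: comm_mxB => //; exact: comm_mx_scalar.
Qed.

Lemma comm_subJ a : comm_mx (a%:M - J) J.
Proof. by apply/comm_mx_sym/comm_mxB => //; exact: comm_mx_scalar. Qed.

Lemma pimxS c : (forall p, (y p)%:M - J \in unitmx) ->
  pimx c.+1 = ((z c)%:M - J) *m phimx c.
Proof.
move=> uy; rewrite /phimx mulmxA.
by have /= -> := comm_pimx c uy (comm_subJ (z c)).
Qed.

Lemma pimx_diff c : (forall p, (y p)%:M - J \in unitmx) ->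
  pimx c - pimx c.+1 = (y c - z c) *: phimx c.
Proof.
move=> uy; rewrite /= /phimx -[X in X - _](mulmxK (uy c)) -/(res _).
rewrite -mulmxBl -mulmxBr opprB addrA subrK -raddfB /= scalemxAl.
by congr (_ *m _); rewrite scalar_mxC mul_scalar_mx.
Qed.

End Resolvent.

Definition ones (C : fieldType) K : 'cV[C]_K := const_mx 1.

Lemma row_ones_mul (C : fieldType) K n (A : 'rV[C]_n) (j : 'I_K) :
  row j (ones C K *m A) = A.
Proof.
by apply/rowP => i; rewrite !mxE big_ord1 !mxE mul1r; congr (A _ _); apply: ord1.
Qed.

Lemma slater_mx (C : fieldType) K n D (w theta : 'I_K -> C) M (y s : nat -> C)
    (A B : nat -> 'rV_n) (U E : nat -> 'M[C]_(K, n)) (S : M.-tuple bool) :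
  alternating D ->
  (forall c j, (c < M)%N -> s c ^- 2 * y c - w j != 0) ->
  (forall c, (c < M)%N -> ((s c ^- 2 * y c)%:M - cascade w theta) *m U c =
     ones C K *m A c - E c.+1) ->
  (forall c, (c < M)%N -> E c = E c.+1 + (s c ^- 2 * y c - y c) *: U c) ->
  (forall c, (c < M)%N -> B c = A c + jump w theta *m U c) ->
  \sum_(out : K.-tuple bool) \sum_S' chain (layers w theta y s (tnth out)) S S' *
    D (sel A S' ++ exits out (fun j => row j (E M))) = D (sel B S).
Proof.
move=> hD z0 hU hE hB.
apply: (slater (U := fun c j => row j (U c)) (E := fun c j => row j (E c))) => //.
- move=> c j cM; have /(congr1 (row j)) := hU c cM.
  rewrite mulmxBl !raddfB /= mul_scalar_mx linearZ /= cascade_mulE row_ones_mul.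
  by move=> /eqP; rewrite opprD addrA -scalerBl subr_eq => /eqP ->; rewrite addrAC.
- by move=> c j cM; rewrite {1}hE // linearD linearZ.
- move=> c cM; rewrite hB //; congr (_ + _); rewrite mulmx_sum_row.
  by apply: eq_bigr => l _; rewrite mxE.
Qed.

Lemma size_exits (C : fieldType) (V : lmodType C) K (out : K.-tuple bool) (e : 'I_K -> V) :
  size (exits out e) = count id out.
Proof. by rewrite size_rev size_mask // size_map size_enum_ord size_tuple. Qed.

Lemma size_sel (V : Type) (A : nat -> V) (S : seq bool) : size (sel A S) = count id S.
Proof. by elim: S A => //= b S IHS A; rewrite size_cat size_nseq IHS. Qed.

Lemma sel0 (C : fieldType) (V : lmodType C) (S : seq bool) :
  sel (fun=> 0 : V) S = nseq (count id S) 0.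
Proof. by elim: S => //= b S IHS; rewrite IHS nseqD. Qed.

Lemma count_id0 (S : seq bool) : count id S = 0%N -> S = nseq (size S) false.
Proof. by elim: S => //= -[] S IHS //= /IHS {1}->. Qed.

Lemma count_id_size (S : seq bool) : count id S = size S -> S = nseq (size S) true.
Proof.
elim: S => //= -[] S IHS /= h; first by congr cons; apply: IHS; case: h.
by have := count_size id S; rewrite -[count id S]add0n h ltnn.
Qed.

Section FDet.
Variables (C : fieldType) (K M : nat) (lam : signature K).
Variables (x r : 'I_K -> C) (y s : nat -> C).
Hypothesis lamM : forall i, part_set lam i -> (i < M)%N.
Hypothesis zx : forall p i, s p ^- 2 * y p - x i != 0.
Hypothesis yx : forall p i, y p - x i != 0.

Let J := cascade x r.
Let z p := s p ^- 2 * y p.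

Lemma det_pimx c :
  \det (pimx J y z c) = \prod_i \prod_(p < c) ((z p - x i) / (y p - x i)).
Proof.
rewrite exchange_big /=; elim: c => [|c IHc] /=; first by rewrite det1 big_ord0.
rewrite big_ord_recr /= !det_mulmx IHc -mulrA; congr (_ * _).
by rewrite det_inv !det_cascade_sub -prodfV -big_split.
Qed.

Lemma F_det : F lam x y r s =
  rdet (sel (fun c => - jump x r *m phimx J y z c) (tuple_of_pred M (part_set lam))).
Proof.
rewrite (F_chain r lamM zx yx).
have uy p : (y p)%:M - J \in unitmx by rewrite unit_cascade_sub; apply/forallP => i.
rewrite -(@slater_mx C K K (@rdet C K) x r M y s (fun=> 0) _ (fun c => - phimx J y z c)
  (pimx J y z)) //.
- pose out1 : K.-tuple bool := nseq_tuple K true.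
  pose S0 := tuple_of_pred M (fun=> false).
  have S0E : S0 = nseq M false :> seq bool.
    apply: (@eq_from_nth _ false) => [|i]; rewrite size_tuple ?size_nseq // => iM.
    by rewrite nth_nseq if_same -[i%N]/(val (Ordinal iM)) -tnth_nth tnth_mktuple.
  rewrite (bigD1 out1) //= [X in _ = _ + X]big1 => [|out nout]; last first.
    rewrite big1 // => S' _; rewrite sel0; have [S'0|] := eqVneq (count id S') 0%N.
      rewrite S'0 cat0s rdet_size ?mulr0 // size_exits; apply: contraNneq nout => h.
      by apply/eqP/val_inj; rewrite /= [LHS]count_id_size ?size_tuple //.
    by case: (count _ _) => // m _; rewrite /= (alternating0 [::]) ?mulr0 //; exact: alternating_rdet.
  rewrite addr0 (bigD1 S0) //= [X in _ = _ + X]big1 ?addr0 => [|S' nS']; last first.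
    rewrite sel0; case S'0: (count id S') => [|m].
      case/eqP: nS'; apply: val_inj; rewrite /= [LHS](count_id0 S'0) size_tuple.
      exact/esym/S0E.
    by rewrite /= (alternating0 [::]) ?mulr0 //; exact: alternating_rdet.
  rewrite mulrC; congr (_ * _).
    by apply: eq_chain => j a b; rewrite /layers tnth_nseq.
  rewrite sel0 S0E count_nseq /= -det_pimx /rdet size_exits /= count_nseq.
  rewrite /= mul1n eqxx /exits revK; congr (\det _); apply/row_matrixP => i; rewrite rowK.
  have sz : size (enum (fintype_ordinal__canonical__fintype_Finite K)) = K by exact: size_enum_ord.
  rewrite mask_true ?size_map //; last by rewrite -enumT sz.
  by rewrite (nth_map i) ?sz // nth_ord_enum.
- exact: alternating_rdet.
- move=> c cM; rewrite mulmx0 sub0r mulmxN; congr (- _).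
  by rewrite (pimxS _ _ uy).
- move=> c cM; rewrite scalerN -scaleNr opprB.
  by rewrite -(pimx_diff _ _ uy) addrC subrK.
- by move=> c cM; rewrite add0r mulmxN mulNmx.
Qed.

End FDet.

Lemma slater_closed (C : fieldType) K n D (w theta : 'I_K -> C) M (y s : nat -> C)
    (A B : nat -> 'rV_n) (U E : nat -> 'M[C]_(K, n)) (S : M.-tuple bool) :
  alternating D ->
  (forall c j, (c < M)%N -> s c ^- 2 * y c - w j != 0) ->
  (forall c, (c < M)%N -> ((s c ^- 2 * y c)%:M - cascade w theta) *m U c =
     ones C K *m A c - E c.+1) ->
  (forall c, (c < M)%N -> E c = E c.+1 + (s c ^- 2 * y c - y c) *: U c) ->
  (forall c, (c < M)%N -> B c = A c + jump w theta *m U c) ->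
  E M = 0 ->
  \sum_S' chain (layers w theta y s (fun=> false)) S S' * D (sel A S') = D (sel B S).
Proof.
move=> hD z0 hU hE hB EM; rewrite -(slater_mx (U := U) (E := E) S hD z0 hU hE hB).
pose out0 : K.-tuple bool := nseq_tuple K false.
rewrite (bigD1 out0) //= [X in _ = _ + X]big1 ?addr0 => [|out nout].
  apply: eq_bigr => S' _; congr (_ * D _).
    by apply: eq_chain => j a b; rewrite /layers tnth_nseq.
  have /size0nil -> : size (exits out0 (fun j => row j (E M))) = 0%N.
    by rewrite size_exits /= count_nseq.
  by rewrite cats0.
rewrite big1 // => S' _.
have ex0 : all (pred1 0) (exits out (fun j => row j (E M))).
  rewrite /exits all_rev; apply/allP => v /mem_mask /mapP[j _ ->].
  by rewrite EM linear0 /= eqxx.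
have /all_pred1P -> := ex0; rewrite size_exits.
case c0 : (count id out) => [|m]; last by rewrite /= alternating0 // mulr0.
case/eqP: nout; apply: val_inj; rewrite /= [LHS]count_id0 ?size_tuple //.
Qed.

Section Positions.
Variables (N : nat) (lam : signature N).

Definition part_pos (j : 'I_N) : nat := tnth (val lam) j + (N - j.+1).

Lemma part_setE i : part_set lam i = (i \in [seq part_pos j | j <- enum 'I_N]).
Proof.
apply/existsP/mapP => [[j /eqP ->]|[j _ ->]]; exists j => //.
by rewrite mem_enum.
Qed.

Lemma part_pos_lt (i j : 'I_N) : (i < j)%N -> (part_pos j < part_pos i)%N.
Proof.
move=> ij; have tij : (tnth (val lam) j <= tnth (val lam) i)%N.
  have := svalP lam; rewrite (tnth_nth 0%N) (tnth_nth 0%N) => srt.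
  have geq_tr : transitive geq by move=> a b c ab bc; exact: leq_trans bc ab.
  by apply: (sorted_ltn_nth geq_tr) => //; rewrite inE size_tuple.
rewrite /part_pos; move: (ltn_ord i) (ltn_ord j); lia.
Qed.

Lemma part_pos_inj : injective part_pos.
Proof.
by move=> i j eij; apply: val_inj; case: (ltngtP i j) => // /part_pos_lt; rewrite eij ltnn.
Qed.

Lemma filter_part_set M : (forall j, (part_pos j < M)%N) ->
  [seq i <- iota 0 M | part_set lam i] = rev [seq part_pos j | j <- enum 'I_N].
Proof.
move=> posM; apply: (irr_sorted_eq ltn_trans ltnn).
- exact: (sorted_filter ltn_trans) (iota_ltn_sorted 0 M).
- rewrite rev_sorted sorted_map; move: (iota_ltn_sorted 0 N).
  rewrite -val_enum_ord sorted_map; apply: sub_sorted => i j /=; exact: part_pos_lt.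
move=> i; rewrite mem_filter mem_iota /= add0n mem_rev -part_setE.
apply/andP/idP => [[] //|hi]; split=> //; move: hi; rewrite part_setE.
by case/mapP => j _ ->.
Qed.

End Positions.

Lemma selE_pred (V : Type) (A : nat -> V) M a :
  sel A (tuple_of_pred M a) = [seq A i | i <- iota 0 M & a i].
Proof.
rewrite selE size_tuple; congr map; apply: eq_in_filter => i.
rewrite mem_iota /= add0n => iM.
by have := tnth_nth false (tuple_of_pred M a) (Ordinal iM); rewrite tnth_mktuple => <-.
Qed.

Section RDet.
Variables (C : fieldType) (N M : nat) (A : nat -> 'rV[C]_N).

Lemma rdet_part_set (lam : signature N) : (forall j, (part_pos lam j < M)%N) ->
  rdet (sel A (tuple_of_pred M (part_set lam))) = \det (\matrix_j A (part_pos lam j)).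
Proof.
move=> posM; rewrite selE_pred filter_part_set // map_rev /rdet size_rev revK.
rewrite -map_comp size_map size_enum_ord eqxx; congr (\det _).
apply/row_matrixP => i; rewrite !rowK (nth_map i) ?size_enum_ord //.
by rewrite nth_ord_enum.
Qed.

Lemma rdet_initial : (N <= M)%N ->
  rdet (sel A (tuple_of_pred M (fun i => (i < N)%N))) =
  \det (\matrix_(i < N) A (N - i.+1)%N).
Proof.
move=> NM; rewrite selE_pred.
have -> : [seq i <- iota 0 M | (i < N)%N] = iota 0 N.
  apply: (irr_sorted_eq ltn_trans ltnn).
  - exact: (sorted_filter ltn_trans) (iota_ltn_sorted 0 M).
  - exact: iota_ltn_sorted.
  by move=> i; rewrite mem_filter !mem_iota /= !add0n andb_idr // => /leq_trans; apply.
rewrite /rdet size_map size_iota eqxx; congr (\det _).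
apply/row_matrixP => i; rewrite !rowK -map_rev (nth_map 0%N) ?size_rev ?size_iota //.
by rewrite nth_rev ?size_iota // nth_iota // rev_ord_proof.
Qed.

End RDet.

Section Indicator.
Variables (C : fieldType) (N M : nat) (lam : signature N).
Hypothesis posM : forall j, (part_pos lam j < M)%N.

Lemma rdet_indicator (S : M.-tuple bool) :
  rdet (sel (fun p => \row_j (p == part_pos lam j)%:R : 'rV[C]_N) S) =
  (S == tuple_of_pred M (part_set lam))%:R.
Proof.
have [->|nS] := eqVneq.
  rewrite rdet_part_set //; apply: etrans (det1 _ N); congr (\det _).
  apply/matrixP => i j; rewrite !mxE; congr (_ %:R); congr nat_of_bool.
  by apply/eqP/eqP => [/part_pos_inj|->].
have [szN|szN] := eqVneq (count id S) N; last by rewrite rdet_size // size_sel.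
have [p Sp np] : exists2 p, nth false S p & ~~ part_set lam p.
  apply: contrapT => nex; case/eqP: nS.
  have sub : {subset [seq i <- iota 0 M | nth false S i] <= [seq part_pos lam j | j <- enum 'I_N]}.
    move=> i; rewrite mem_filter -part_setE => /andP[Si _]; apply: contrapT => /negP ni.
    by apply: nex; exists i.
  have [//||_ same] := uniq_min_size _ sub.
  - by rewrite filter_uniq // iota_uniq.
  - rewrite size_map size_enum_ord size_filter -{1}szN leq_eqVlt; apply/orP; left; apply/eqP.
    have -> : (S : seq bool) = mkseq (nth false S) M.
      by apply: etrans (esym (mkseq_nth false S)) _; rewrite size_tuple.
    by rewrite /mkseq count_map; apply: eq_in_count => i; rewrite mem_iota => ?; rewrite /= nth_mkseq.
  apply: eq_from_tnth => i; rewrite tnth_mktuple part_setE -same mem_filter mem_iota.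
  by rewrite ltn_ord /= andbT (tnth_nth false).
have pM : (p < M)%N.
  by rewrite ltnNge; apply: contraTN Sp => Mp; rewrite nth_default ?size_tuple.
have : 0 \in sel (fun p => \row_j (p == part_pos lam j)%:R : 'rV[C]_N) S.
  rewrite selE; apply/mapP; exists p; first by rewrite mem_filter Sp mem_iota size_tuple.
  apply/rowP => j; rewrite !mxE; case: eqP => // e; case/negP: np.
  by rewrite part_setE e map_f // mem_enum.
by case/splitPr => s1 s2; rewrite (alternating0 _ _ (@alternating_rdet C N)).
Qed.

End Indicator.

Section OneParticle.
Variables (C : fieldType) (K : nat) (w theta : 'I_K -> C) (y s : nat -> C).
Hypothesis zw : forall p j, s p ^- 2 * y p - w j != 0.

Let J := cascade w theta.
Let z p := s p ^- 2 * y p.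

Let uz p : (z p)%:M - J \in unitmx.
Proof. by rewrite unit_cascade_sub; apply/forallP => i; exact: zw. Qed.

Definition hop p : 'M[C]_K := res J (z p) *m ((y p)%:M - J).

Fixpoint hops a d : 'M[C]_K := if d is d'.+1 then hop a *m hops a.+1 d' else 1%:M.

Lemma hopE p : hop p = 1%:M - (z p - y p) *: res J (z p).
Proof.
rewrite /hop -[in RHS](mulVmx (uz p)) -/(res J _) -mul_mx_scalar -mulmxBr.
by congr (_ *m _); rewrite raddfB /= addrAC subKr.
Qed.

Definition turn_up q : 'cV_K := (z q - y q) *: (res J (z q) *m ones C K).

Definition reach c q : 'cV_K :=
  if (c <= q)%N then hops c (q - c) *m turn_up q else 0.

(* Amplitude of a path going through all the rows from the bottom of column [i] to
   the top of column [q]; [reach c q] lists, row by row, the amplitudes of the paths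
   entering column [c] from the left and ending at the top of column [q]. *)
Definition tau i q : C :=
  (i == q)%:R + (jump w theta *m (res J (z i) *m
    ((i == q)%:R *: ones C K - reach i.+1 q))) 0 0.

Lemma reach_step c q :
  reach c q = reach c.+1 q + (z c - y c) *:
    (res J (z c) *m ((c == q)%:R *: ones C K - reach c.+1 q)).
Proof.
rewrite /reach; case: ltngtP => [cq|cq|->].
- have -> : (q - c)%N = (q - c.+1).+1 by lia.
  rewrite /= scale0r sub0r mulmxN scalerN scalemxAl.
  by rewrite -mulmxA hopE mulmxBl mul1mx.
- by rewrite scale0r subr0 mulmx0 scaler0 addr0.
- by rewrite subnn /= mul1mx scale1r subr0 add0r.
Qed.

Lemma G_det N (lam : signature N) :
  G lam w y theta s = \det (\matrix_(i < N, j < N) tau (N - i.+1)%N (part_pos lam j)).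
Proof.
have [M NM posM] : exists2 M, (N <= M)%N & forall j, (part_pos lam j < M)%N.
  exists (N + \sum_j part_pos lam j).+1%N; first by rewrite -addnS leq_addr.
  by move=> j; rewrite ltnS (bigD1 j) //= addnCA leq_addr.
have partM i : part_set lam i -> (i < M)%N.
  by rewrite part_setE => /mapP[j _ ->].
rewrite (G_chain w theta y s NM partM).
pose A p : 'rV[C]_N := \row_j (p == part_pos lam j)%:R.
pose E c : 'M[C]_(K, N) := \matrix_(l, j) reach c (part_pos lam j) l 0.
pose U c := res J (z c) *m (ones C K *m A c - E c.+1).
pose B c := A c + jump w theta *m U c.
have Ucol c j : col j (U c) = res J (z c) *m
    ((c == part_pos lam j)%:R *: ones C K - reach c.+1 (part_pos lam j)).
  rewrite colE /U -mulmxA -colE; congr (_ *m _); apply/colP => l.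
  by rewrite !mxE big_ord1 !mxE mul1r mulr1.
set S0 := tuple_of_pred M _; set S1 := tuple_of_pred M (part_set lam).
transitivity (\sum_S' chain (layers w theta y s (fun=> false)) S0 S' * rdet (sel A S')).
  rewrite (bigD1 S1) // rdet_indicator // eqxx mulr1 big1 => [|S' /negbTE nS].
    exact/esym/addr0.
  by rewrite rdet_indicator // nS mulr0.
rewrite (slater_closed (B := B) (U := U) (E := E) S0 (@alternating_rdet C N)) //.
- rewrite rdet_initial //.
  congr (\det _); apply/matrixP => i j; rewrite !mxE /tau; congr (_ + _).
  by rewrite mxE; apply: eq_bigr => l _; rewrite -Ucol; congr (_ * _); rewrite [RHS]mxE.
- by move=> c _; rewrite /U [LHS]mulmxA (mulmxV (uz c)) mul1mx.
- move=> c cM; apply/matrixP => l j.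
  have := reach_step c (part_pos lam j); rewrite -Ucol => /(congr1 (fun v : 'cV_K => v l 0)).
  by rewrite /E !mxE.
- apply/matrixP => l j; rewrite !mxE /reach leqNgt posM mxE //.
Qed.

Variables (N : nat) (Jx : 'M[C]_N) (v v' : 'rV[C]_N) (Y : 'M[C]_(K, N)).
Hypothesis uy : forall p, (y p)%:M - Jx \in unitmx.
Hypothesis sylvester : J *m Y - Y *m Jx = ones C K *m v.
Hypothesis v'E : v' = v - jump w theta *m Y.

Definition truncated M i : 'rV_N :=
  v' *m phimx Jx y z i +
  jump w theta *m (res J (z i) *m (hops i.+1 (M - i.+1)%N *m Y *m pimx Jx y z M)).

(* Solution of the recursion behind [slater] that vanishes at column [M]: the
   stationary solution [Y * pimx] minus a solution of the homogeneous recursion. *)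
Lemma truncated_sum M (S : M.-tuple bool) D : alternating D ->
  \sum_(S' : M.-tuple bool) chain (layers w theta y s (fun=> false)) S S' *
    D (sel (fun c => v *m phimx Jx y z c) S') = D (sel (truncated M) S).
Proof.
move=> hD.
pose E c := Y *m pimx Jx y z c - hops c (M - c)%N *m Y *m pimx Jx y z M.
pose U c := - (Y *m phimx Jx y z c) +
  res J (z c) *m (hops c.+1 (M - c.+1)%N *m Y *m pimx Jx y z M).
apply: (slater_closed (U := U) (E := E)) => //.
- move=> c cM; rewrite /U mulmxDr [X in _ + X]mulmxA (mulmxV (uz c)) mul1mx mulmxN /E.
  rewrite opprB [RHS]addrCA [LHS]addrC; congr (_ + _).
  rewrite pimxS //; move: (phimx Jx y z c) => ph.
  rewrite !mulmxA -sylvester -mulmxBl -mulNmx; congr (_ *m _).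
  by rewrite mulmxBl mulmxBr scalar_mxC !opprB addrA subrK.
- move=> c cM; rewrite /E /U scalerDr.
  have -> : (M - c)%N = (M - c.+1).+1 by lia.
  have /eqP := pimx_diff z c uy; rewrite subr_eq => /eqP ->.
  move: (pimx Jx y z c.+1) (phimx Jx y z c) (pimx Jx y z M) => p ph pM.
  rewrite /= hopE -!mulmxA mulmxBl mul1mx -scalemxAl opprB mulmxDr -scalemxAr.
  move: (hops _ _ *m (Y *m pM)) => H; rewrite -/(z c) scalerN -scaleNr opprB.
  by rewrite [LHS]addrACA addrC.
- move=> c cM; rewrite /truncated /U mulmxDr addrA v'E; congr (_ + _).
  by move: (phimx Jx y z c) => ph; rewrite mulmxN mulmxBl mulmxA.
- by rewrite /E subnn mul1mx subrr.
Qed.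

End OneParticle.

Lemma sylvester_rows (C : fieldType) N (Jx : 'M[C]_N) (v : 'rV_N) K (w theta : 'I_K -> C) :
  (forall j, (w j)%:M - Jx \in unitmx) ->
  exists (Y : 'I_K -> 'rV_N) (g : 'M[C]_N),
  [/\ forall j, Y j *m ((w j)%:M - Jx) =
        v - \sum_(l < K | (j < l)%N) (w l * (1 - theta l ^- 2)) *: Y l,
      v - \sum_l (w l * (1 - theta l ^- 2)) *: Y l = v *m g,
      comm_mx g Jx &
      \det g = \prod_j (\det ((theta j ^- 2 * w j)%:M - Jx) / \det ((w j)%:M - Jx))].
Proof.
elim: K w theta => [|K IHK] w theta uw.
  exists (fun=> 0), 1%:M; split.
  - by case.
  - by rewrite big_ord0 subr0 mulmx1.
  - exact: comm1mx.
  - by rewrite det1 big_ord0.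
have [Y [g [hY hv cg dg]]] := IHK (fun j => w (lift ord0 j)) (fun j => theta (lift ord0 j))
  (fun j => uw (lift ord0 j)).
pose w0 := w ord0; pose g0 := ((theta ord0 ^- 2 * w0)%:M - Jx) *m res Jx w0.
pose Y' j := if unlift ord0 j is Some l then Y l else v *m g *m res Jx w0.
have Y'l l : Y' (lift ord0 l) = Y l by rewrite /Y' liftK.
have Y'0 : Y' ord0 = v *m g *m res Jx w0 by rewrite /Y' unlift_none.
have sumY' : \sum_(l < K.+1 | (0 < l)%N) (w l * (1 - theta l ^- 2)) *: Y' l =
    \sum_l (w (lift ord0 l) * (1 - theta (lift ord0 l) ^- 2)) *: Y l.
  rewrite big_mkcond big_ord_recl /= add0r.
  by apply: eq_bigr => l _; rewrite Y'l.
exists Y', (g *m g0); split.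
- move=> j; case: (unliftP ord0 j) => [l|] ->; last first.
    by rewrite Y'0 sumY' hv /res (mulmxKV (uw ord0)).
  rewrite Y'l hY; congr (_ - _); rewrite [RHS]big_mkcond big_ord_recl /= add0r -big_mkcond.
  by apply: eq_bigr => i _; rewrite Y'l.
- rewrite big_ord_recl Y'0 (eq_bigr (fun l => (w (lift ord0 l) *
    (1 - theta (lift ord0 l) ^- 2)) *: Y l)) => [|l _]; last by rewrite Y'l.
  rewrite opprD addrCA hv mulmxA -[X in _ + X = _](mulmxK (uw ord0)) -/w0 -/(res Jx w0).
  rewrite /g0 mulmxA scalemxAl -mulNmx -mulmxDl; congr (_ *m _).
  rewrite -mul_mx_scalar -mulmxN -mulmxDr; congr (_ *m _).
  rewrite addrA -rmorphN -raddfD /=; congr (_%:M - _).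
  by rewrite mulrBr mulr1 opprB subrK mulrC.
- apply/comm_mx_sym/comm_mxM; first exact: comm_mx_sym.
  apply: comm_mxM; first exact/comm_mx_sym/comm_subJ.
  by apply: comm_mxV; [exact: uw|exact/comm_mx_sym/comm_subJ].
- by rewrite !det_mulmx dg det_inv big_ord_recl mulrC.
Qed.

Lemma sylvester_solution (C : fieldType) N (Jx : 'M[C]_N) (v : 'rV_N) K (w theta : 'I_K -> C) :
  (forall j, (w j)%:M - Jx \in unitmx) ->
  exists (Y : 'M[C]_(K, N)) (g : 'M[C]_N),
  [/\ cascade w theta *m Y - Y *m Jx = ones C K *m v,
      v *m g = v - jump w theta *m Y,
      comm_mx g Jx &
      \det g = \prod_j (\det ((theta j ^- 2 * w j)%:M - Jx) / \det ((w j)%:M - Jx))].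
Proof.
move=> uw; have [Y [g [hY hv cg dg]]] := sylvester_rows v theta uw.
exists (\matrix_j Y j), g; split=> //.
  apply/row_matrixP => j; rewrite raddfB /= cascade_mulE row_ones_mul row_mul rowK.
  rewrite (eq_bigr (fun l => (w l * (1 - theta l ^- 2)) *: Y l)) => [|l _]; last by rewrite rowK.
  have := hY j; rewrite mulmxBr mul_mx_scalar => /eqP; rewrite subr_eq => /eqP ->.
  by rewrite addrAC addrK subrK.
rewrite -hv mulmx_sum_row; congr (_ - _); apply: eq_bigr => l _.
by rewrite mxE rowK.
Qed.

(** * Evaluation of the determinant of F *)

Section PhiDet.
Variable C : fieldType.

Definition otail n (f : 'I_n.+1 -> C) (j : 'I_n) : C := f (lift ord0 j).

Definition pad0 n (u : 'rV[C]_n) : 'rV[C]_n.+1 := row_mx (0 : 'rV_1) u.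

Lemma pad0Z n a (u : 'rV_n) : a *: pad0 u = pad0 (a *: u).
Proof.
apply/rowP => j; rewrite mxE /pad0 [in RHS]mxE [X in _ * X]mxE.
by case: splitP => i _; rewrite !mxE ?mulr0.
Qed.

Lemma pad0_0 n (u : 'rV_n) : pad0 u 0 ord0 = 0.
Proof.
have -> : ord0 = lshift n (ord0 : 'I_1) by apply: val_inj.
exact: etrans (row_mxEl _ _ _ _) (mxE _ _ _ _).
Qed.

Lemma pad0_lift n (u : 'rV_n) : \row_j pad0 u 0 (lift ord0 j) = u.
Proof.
apply/rowP => j; rewrite mxE (_ : lift ord0 j = rshift 1 j); last by apply: val_inj.
exact: row_mxEr.
Qed.

Lemma jump_rec n (x r : 'I_n.+1 -> C) :
  jump x r = row_mx ((x ord0 * (1 - r ord0 ^- 2))%:M : 'M[C]_1)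
    (jump (otail x) (otail r)) :> 'rV_(1 + n).
Proof.
apply/rowP => j; rewrite !mxE; case: splitP => [k|k] jk.
  by rewrite !mxE !ord1 eqxx mulr1n (_ : j = ord0) //; apply: val_inj; rewrite /= jk ord1.
by rewrite mxE (_ : j = lift ord0 k) //; apply: val_inj.
Qed.

Lemma cascade_rec n (x r : 'I_n.+1 -> C) :
  cascade x r = block_mx ((x ord0)%:M : 'M[C]_1)
    (jump (otail x) (otail r)) 0
    (cascade (otail x) (otail r)) :> 'M[C]_(1 + n).
Proof.
apply/matrixP => i j; rewrite !mxE; case: splitP => [k|k] ik; rewrite mxE; case: splitP => [l|l] jl.
- have [-> ->] : i = ord0 /\ j = ord0.
    by split; apply: val_inj; rewrite /= ?ik ?jl ord1.
  by rewrite !mxE !ord1 eqxx mulr1n.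
- have [-> ->] : i = ord0 /\ j = lift ord0 l.
    by split; apply: val_inj; rewrite /= ?ik ?jl ?ord1.
  by rewrite mxE.
- have [-> ->] : i = lift ord0 k /\ j = ord0.
    by split; apply: val_inj; rewrite /= ?ik ?jl ?ord1.
  by rewrite !mxE.
- have [-> ->] : i = lift ord0 k /\ j = lift ord0 l.
    by split; apply: val_inj; rewrite /= ?ik ?jl.
  by rewrite mxE (inj_eq lift_inj).
Qed.

Lemma phimxS n (J : 'M[C]_n) (y z : nat -> C) p : (forall p, (y p)%:M - J \in unitmx) ->
  phimx J y z p.+1 = phimx J y z p *m ((z p)%:M - J) *m res J (y p.+1).
Proof.
move=> uy; rewrite /phimx /= -!mulmxA; congr (_ *m _).
by rewrite [LHS]mulmxA (comm_res (z p) (uy p)) -mulmxA.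
Qed.

(* [phimx] for the shifted [y] and the unshifted [z]: the form in which the size
   [n] determinant appears inside the one of size [n.+1]. *)
Lemma phimx_shift n (J : 'M[C]_n) (y z : nat -> C) p : (forall p, (y p)%:M - J \in unitmx) ->
  phimx J y z p *m res J (y p.+1) = res J (y 0%N) *m phimx J (y \o succn) z p.
Proof.
move=> uy; elim: p => [|p IHp]; first by rewrite /phimx /= !mul1mx.
have uy' q : ((y \o succn) q)%:M - J \in unitmx by exact: uy.
rewrite (phimxS z p uy) (phimxS z p uy') 2!(mulmxA (res J (y 0%N))) -IHp.
congr (_ *m _); move: (phimx J y z p) => ph.
by rewrite -!mulmxA (comm_res (z p) (uy p.+1)).
Qed.

Lemma sub_cascade_rec n (x r : 'I_n.+1 -> C) a :
  a%:M - cascade x r = block_mx ((a - x ord0)%:M : 'M[C]_1) (- jump (otail x) (otail r)) 0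
    (a%:M - cascade (otail x) (otail r)) :> 'M[C]_(1 + n).
Proof.
transitivity ((a%:M : 'M[C]_(1 + n)) - (cascade x r : 'M[C]_(1 + n))) => //.
by rewrite cascade_rec (scalar_mx_block 1 n) opp_block_mx add_block_mx raddfB /= sub0r oppr0 addr0.
Qed.

Lemma pad0_mul_cascade n (x r : 'I_n.+1 -> C) (u : 'rV_n) a :
  pad0 u *m (a%:M - cascade x r) = pad0 (u *m (a%:M - cascade (otail x) (otail r))).
Proof.
apply: etrans (congr1 (mulmx (pad0 u)) (sub_cascade_rec x r a)) _.
apply: etrans (mul_row_block (0 : 'rV_1) u _ _ _ _) _.
by rewrite !mul0mx mulmx0 !add0r.
Qed.

Lemma pad0_mul_res n (x r : 'I_n.+1 -> C) (u : 'rV_n) a : (forall i, a - x i != 0) ->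
  pad0 u *m res (cascade x r) a =
  pad0 (u *m res (cascade (otail x) (otail r)) a).
Proof.
move=> ax.
have ua : a%:M - cascade x r \in unitmx by rewrite unit_cascade_sub; apply/forallP.
have ua' : a%:M - cascade (otail x) (otail r) \in unitmx.
  by rewrite unit_cascade_sub; apply/forallP => j; exact: ax.
by apply: (canLR (mulmxK ua)); rewrite pad0_mul_cascade mulmxKV.
Qed.

Lemma pad0_mul_phimx n (x r : 'I_n.+1 -> C) (u : 'rV_n) (y z : nat -> C) p :
  (forall p i, y p - x i != 0) ->
  pad0 u *m phimx (cascade x r) y z p =
  pad0 (u *m phimx (cascade (otail x) (otail r)) y z p).
Proof.
move=> yx; rewrite /phimx !mulmxA; rewrite -pad0_mul_res //; congr (_ *m _).
elim: p => [|p IHp] /=; first by rewrite !mulmx1.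
by rewrite !mulmxA IHp pad0_mul_cascade pad0_mul_res.
Qed.

Lemma jump_mul_sub n (x r : 'I_n.+1 -> C) :
  - jump x r *m (cascade x r - (x ord0)%:M) =
  pad0 (- jump (otail x) (otail r) *m
    (cascade (otail x) (otail r) -
     (r ord0 ^- 2 * x ord0)%:M)).
Proof.
rewrite -(opprB _ (cascade x r)) -(opprB _ (cascade (otail x) _)) !mulmxN -!mulNmx !opprK.
apply: etrans (congr2 mulmx (jump_rec x r) (sub_cascade_rec x r (x ord0))) _.
apply: etrans (mul_row_block _ _ _ _ _ _) _.
rewrite subrr raddf0 !mulmx0 addr0; congr row_mx.
rewrite mul_scalar_mx scalerN -scaleNr -mul_mx_scalar -mulmxDr; congr (_ *m _).
rewrite addrA -raddfD /=; congr (_%:M - _).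
by rewrite mulrBr mulr1 opprB subrK mulrC.
Qed.

Lemma phi_eliminate n (x r : 'I_n.+1 -> C) (y z : nat -> C) p :
  (forall p i, y p - x i != 0) ->
  - jump x r *m phimx (cascade x r) y z p.+1 -
    ((z p - x ord0) / (y p.+1 - x ord0)) *: (- jump x r *m phimx (cascade x r) y z p) =
  pad0 (((z p - y p.+1) / (y p.+1 - x ord0)) *:
    (- jump (otail x) (otail r) *m
       phimx (cascade (otail x) (otail r)) (y \o succn) z p *m
       ((cascade (otail x) (otail r) - (r ord0 ^- 2 * x ord0)%:M) *m
        res (cascade (otail x) (otail r)) (y 0%N)))).
Proof.
move=> yx.
have uy q : (y q)%:M - cascade x r \in unitmx by rewrite unit_cascade_sub; apply/forallP.
have uy' q : (y q)%:M - cascade (otail x) (otail r) \in unitmx.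
  by rewrite unit_cascade_sub; apply/forallP => i; exact: yx.
have uyS q : ((y \o succn) q)%:M - cascade (otail x) (otail r) \in unitmx by exact: uy'.
set v := - jump x r; set J := cascade x r; set v' := - jump _ _; set J' := cascade _ _.
set c := _ / _; set k := (z p - y p.+1) / _.
have kE : (z p)%:M - J - c *: ((y p.+1)%:M - J) = k *: (J - (x ord0)%:M).
  move: J {uy} (yx p.+1 ord0) => J yx0; rewrite /c /k; apply/matrixP => i j.
  by rewrite !mxE; case: (i == j); rewrite ?mulr1n ?mulr0n; field.
rewrite (phimxS z p uy) mulmxA [v *m (_ *m _)]mulmxA.
rewrite -[X in _ - _ *: X](mulmxK (uy p.+1)) -/(res J _) scalemxAl -mulmxBl.
rewrite scalemxAr -mulmxBr kE -scalemxAr -scalemxAl.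
rewrite -[_ *m phimx J y z p *m (J - _)]mulmxA.
have <- : comm_mx (J - (x ord0)%:M) (phimx J y z p).
  apply: comm_phimx => //; apply/comm_mx_sym/comm_mxB => //; exact: comm_mx_scalar.
rewrite mulmxA jump_mul_sub pad0_mul_phimx // pad0_mul_res // -/v' -/J'.
rewrite -[_ *m phimx J' y z p *m _]mulmxA phimx_shift //.
rewrite pad0Z; congr (pad0 (_ *: _)).
have c1 : comm_mx (res J' (y 0%N)) (phimx J' (y \o succn) z p).
  by apply: comm_phimx => //; apply: comm_mx_sym; apply: comm_mxV => //; exact/comm_mx_sym/comm_subJ.
have c2 : comm_mx (J' - (r ord0 ^- 2 * x ord0)%:M) (phimx J' (y \o succn) z p).
  by apply: comm_phimx => //; apply/comm_mx_sym/comm_mxB => //; exact: comm_mx_scalar.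
move: (phimx J' _ z p) c1 c2 => ph c1 c2.
by rewrite c1 -!mulmxA; congr (_ *m _); rewrite !mulmxA c2.
Qed.

Lemma corner_phi0 n (x r : 'I_n.+1 -> C) (y z : nat -> C) : (forall p i, y p - x i != 0) ->
  (- jump x r *m phimx (cascade x r) y z 0) 0 ord0 =
  - (x ord0 * (1 - r ord0 ^- 2)) / (y 0%N - x ord0).
Proof.
move=> yx; rewrite /phimx /= mul1mx; set u := _ *m _.
have uy : (y 0%N)%:M - cascade x r \in unitmx by rewrite unit_cascade_sub; apply/forallP.
have : (u *m ((y 0%N)%:M - cascade x r)) 0 ord0 = (- jump x r) 0 ord0.
  by rewrite /u /res mulmxKV.
rewrite mxE (bigD1 ord0) //= big1 ?addr0 => [|j j0]; last first.
  have -> : ((y 0%N)%:M - cascade x r) j ord0 = 0 by rewrite !mxE (negbTE j0) subrr.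
  by rewrite mulr0.
have -> : ((y 0%N)%:M - cascade x r) ord0 ord0 = y 0%N - x ord0 by rewrite !mxE eqxx.
by rewrite !mxE => <-; rewrite mulfK.
Qed.

Lemma det_phi n (x r : 'I_n -> C) (y z : nat -> C) : (forall p i, y p - x i != 0) ->
  \det (\matrix_(i < n) (- jump x r *m phimx (cascade x r) y z (n - i.+1)%N)) =
  (\prod_(i < n) \prod_(j < n | (i <= j)%N) (r i ^- 2 * x i - x j)) *
  (\prod_(i < n) \prod_(j < n | (i < j)%N) (z i - y j)) /
  (\prod_(i < n) \prod_(j < n) (y i - x j)).
Proof.
elim: n x r y => [|n IHn] x r y yx.
  by rewrite det_mx00 !big_ord0 mulr1 divr1.
set R := fun p => - jump x r *m phimx (cascade x r) y z p.
pose c p := (z p - x ord0) / (y p.+1 - x ord0).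
pose L : 'M[C]_n.+1 := \matrix_(i, j) ((j == i)%:R - (if j == i.+1 :> nat then c (n - i.+1)%N else 0)).
set M := \matrix_i _.
have detL : \det L = 1.
  rewrite -det_tr det_trig; last first.
    apply/is_trig_mxP => i j ij; rewrite !mxE -val_eqE /= ltn_eqF // ltn_eqF ?subrr //.
    exact: leqW.
  by rewrite big1 // => i _; rewrite !mxE eqxx ltn_eqF // subr0.
have rowL i : row i (L *m M) = row i M - \sum_(j < n.+1 | j == i.+1 :> nat) c (n - i.+1)%N *: row j M.
  rewrite row_mul mulmx_sum_row (eq_bigr (fun j => (j == i)%:R *: row j M -
    (if j == i.+1 :> nat then c (n - i.+1)%N else 0) *: row j M)) => [|j _]; last first.
    by rewrite !mxE scalerBl.
  rewrite sumrB; congr (_ - _).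
    rewrite (bigD1 i) //= eqxx scale1r big1 ?addr0 // => j /negbTE ->.
    by rewrite scale0r.
  rewrite [RHS]big_mkcond; apply: eq_bigr => j _.
  by case: ifP; rewrite ?scale0r.
have rowM i : row i M = R (n - i)%N by rewrite rowK subSS.
have row_max : row ord_max (L *m M) = R 0%N.
  rewrite rowL rowM /= subnn big_pred0 ?subr0 // => j.
  by rewrite ltn_eqF.
pose kap p := (z p - y p.+1) / (y p.+1 - x ord0).
pose B := (cascade (otail x) (otail r) - (r ord0 ^- 2 * x ord0)%:M) *m
        res (cascade (otail x) (otail r)) (y 0%N).
have row_lift (k : 'I_n) : row (lift ord_max k) (L *m M) =
    pad0 (kap (n - k.+1)%N *: (- jump (otail x) (otail r) *m
       phimx (cascade (otail x) (otail r)) (y \o succn) z (n - k.+1)%N *m B)).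
  rewrite rowL !rowM lift_max (big_pred1 (lift ord0 k)) => [|j]; last first.
    by rewrite /= -val_eqE /= /bump /= add1n.
  rewrite rowM /= /bump /= add1n -(phi_eliminate r z) //.
  by have -> : (n - k = (n - k.+1).+1)%N by rewrite subnSK.
have -> : \det M = \det (L *m M) by rewrite det_mulmx detL mul1r.
rewrite (expand_det_col _ ord0) big_ord_recr /= big1 ?add0r => [|i _]; last first.
  have := congr1 (fun v : 'rV_n.+1 => v 0 ord0) (row_lift i).
  rewrite mxE => h; rewrite (_ : widen_ord _ i = lift ord_max i); last first.
    by apply: val_inj; rewrite /= /bump leqNgt ltn_ord.
  by move: h; rewrite mxE => ->; rewrite pad0_0 mul0r.
have -> : (L *m M) ord_max ord0 = - (x ord0 * (1 - r ord0 ^- 2)) / (y 0%N - x ord0).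
  by rewrite -(corner_phi0 r z) // -[_ *m _ in RHS]/(R 0%N) -row_max [in RHS]mxE.
rewrite /cofactor.
have -> : row' ord_max (col' ord0 (L *m M)) = diag_mx (\row_k kap (n - k.+1)%N) *m
   (\matrix_(i < n) (- jump (otail x) (otail r) *m
       phimx (cascade (otail x) (otail r)) (y \o succn) z (n - i.+1)%N)) *m B.
  apply/row_matrixP => k; rewrite -mulmxA row_mul row_diag_mx -scalemxAl -rowE.
  rewrite row_mul rowK mxE -(pad0_lift (kap _ *: _)) -row_lift.
  by apply/rowP => j; rewrite !mxE.
rewrite 2!det_mulmx det_diag IHn; last by move=> p i; exact: yx.
set D := \det B.
have DE : D = (-1) ^+ n * \prod_j (r ord0 ^- 2 * x ord0 - otail x j) / \prod_j (y 0%N - otail x j).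
  rewrite /D det_mulmx det_inv det_cascade_sub; congr (_ / _).
  by rewrite -opprB -scaleN1r detZ det_cascade_sub.
have kapE : \prod_(i < n) (\row_(k < n) kap (n - k.+1)%N) 0 i =
    (\prod_(i < n) (z i - y i.+1)) / \prod_(i < n) (y i.+1 - x ord0).
  rewrite -prodf_div [RHS](reindex_inj rev_ord_inj) /=; apply: eq_bigr => i _.
  by rewrite mxE.
have zE : \prod_(i < n.+1) \prod_(j < n.+1 | (i < j)%N) (z i - y j) =
   (\prod_(i < n) (z i - y i.+1)) *
   \prod_(i < n) \prod_(j < n | (i < j)%N) (z i - (y \o succn) j).
  rewrite big_ord_recr /= [X in _ * X]big_pred0 ?mulr1 => [|j]; last first.
    by rewrite ltnNge -ltnS ltn_ord.
  rewrite -big_split; apply: eq_bigr => i _.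
  rewrite big_mkcond big_ord_recl /= mul1r -big_mkcond /= (bigD1 i) //=.
  congr (_ * _); apply: eq_bigl => j; rewrite /bump /= add1n ltnS -val_eqE /=.
  by rewrite ltn_neqAle eq_sym andbC.
have rE : \prod_(i < n.+1) \prod_(j < n.+1 | (i <= j)%N) (r i ^- 2 * x i - x j) =
   (r ord0 ^- 2 * x ord0 - x ord0) * \prod_j (r ord0 ^- 2 * x ord0 - otail x j) *
   \prod_(i < n) \prod_(j < n | (i <= j)%N) (otail r i ^- 2 * otail x i - otail x j).
  rewrite big_ord_recl big_ord_recl; congr (_ * _); apply: eq_bigr => i _.
  by rewrite big_mkcond big_ord_recl /= mul1r -big_mkcond.
have yE : \prod_(i < n.+1) \prod_(j < n.+1) (y i - x j) =
   (y 0%N - x ord0) * \prod_j (y 0%N - otail x j) * \prod_(i < n) (y i.+1 - x ord0) *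
   \prod_(i < n) \prod_(j < n) ((y \o succn) i - otail x j).
  rewrite big_ord_recl big_ord_recl -!mulrA; congr (_ * (_ * _)).
  by rewrite -big_split; apply: eq_bigr => i _; rewrite big_ord_recl.
rewrite kapE DE zE rE yE addn0.
rewrite mulrBr mulr1 opprB -[x ord0 * r ord0 ^- 2]mulrC.
have aux (t a b p1 p2 p3 p4 p5 p6 p7 : C) : t * t = 1 ->
    a / b * (t * (p1 / p2 * (p3 * p4 / p5) * (t * p6 / p7))) =
    a * p6 * p3 * (p1 * p4) / (b * p7 * p2 * p5).
  move=> tt; rewrite !invfM; transitivity (t * t *
    (a * p6 * p3 * (p1 * p4) * (b^-1 * p7^-1 * p2^-1 * p5^-1))); first by ring.
  by rewrite tt mul1r.
by apply: aux; rewrite -exprMn mulrNN mulr1 expr1n.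
Qed.

End PhiDet.

(** * Geometric decay of the one-particle amplitudes *)

Section ResolventBound.
Variables (C : numFieldType) (K : nat) (w theta : 'I_K -> C).

Let J := cascade w theta.

Lemma res_cascadeE a j l : (forall i, a - w i != 0) ->
  (a - w j) * res J a j l =
  (j == l)%:R + \sum_(m < K | (j < m)%N) (w m * (1 - theta m ^- 2)) * res J a m l.
Proof.
move=> ha; have ua : a%:M - J \in unitmx by rewrite unit_cascade_sub; apply/forallP.
have /(congr1 (row j)) := mulmxV ua; rewrite -/(res J a).
rewrite mulmxBl raddfB /= mul_scalar_mx linearZ /= cascade_mulE opprD addrA -scalerBl.
move=> /eqP; rewrite subr_eq => /eqP /(congr1 (fun v : 'rV_K => v 0 l)).
rewrite !mxE summxE => ->; congr (_ + _).
by apply: eq_bigr => m _; rewrite !mxE.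
Qed.

Lemma res_cascade_lower a (j l : 'I_K) : (forall i, a - w i != 0) -> (l < j)%N -> res J a j l = 0.
Proof.
move=> ha lj; have [m] : exists m, (K - j <= m)%N by exists (K - j)%N.
elim: m j lj => [|m IHm] j lj jm; first by move: (ltn_ord j); lia.
apply: (mulfI (ha j)); rewrite mulr0 res_cascadeE // -val_eqE gtn_eqF // add0r big1 // => i ji.
by rewrite IHm ?mulr0 //; [exact: ltn_trans ji|move: (ltn_ord i); lia].
Qed.

Lemma res_cascade_diag a j : (forall i, a - w i != 0) -> res J a j j = (a - w j)^-1.
Proof.
move=> ha; apply: (mulfI (ha j)); rewrite mulfV // res_cascadeE // eqxx big1 ?addr0 // => m jm.
by rewrite res_cascade_lower ?mulr0.
Qed.

(* Only the [w l0] nearest to [a] may be close to it: all the others stay at a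
   distance of order [1 + |a|]. *)
Let far c a l0 := forall l, l != l0 -> `|a - w l|^-1 <= c / (1 + `|a|).

Let P := \sum_m `|w m * (1 - theta m ^- 2)|.

Let sum_bound a (j l : 'I_K) b (B : C) : 0 <= B -> 0 <= b ->
  (forall m : 'I_K, (j < m)%N -> `|res J a m l| <= B * b) ->
  `|\sum_(m < K | (j < m)%N) (w m * (1 - theta m ^- 2)) * res J a m l| <= P * B * b.
Proof.
move=> B0 b0 hb; apply: le_trans (ler_norm_sum _ _ _) _.
rewrite -mulrA /P mulr_suml big_mkcond; apply: ler_sum => m _.
case: ifP => jm; last by rewrite mulr_ge0 // mulr_ge0.
by rewrite normrM ler_wpM2l // hb.
Qed.

Lemma res_cascade_induct c c' m : 0 <= c -> 0 <= c' -> exists2 B, 0 <= B &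
  forall a l0, (forall i, a - w i != 0) -> far c a l0 ->
  (1 + `|a|)^-1 <= c' / `|a - w l0| ->
  forall j l : 'I_K, (K <= j + m)%N ->
  [/\ `|res J a j l| <= B * `|a - w l0|^-1,
      j != l -> `|res J a j l| <= B * (`|a - w l0|^-1 / (1 + `|a|)) &
      (l0 < j)%N -> `|res J a j l| <= B / (1 + `|a|)].
Proof.
move=> c0 c'0; have P0 : 0 <= P by apply: sumr_ge0.
elim: m => [|m [B B0 IHm]].
  by exists 0 => // a l0 _ _ _ j l; rewrite addn0 leqNgt ltn_ord.
pose B' := B + 1 + c + c * c' + P * B + c * P * B.
have B'0 : 0 <= B' by rewrite !addr_ge0 ?mulr_ge0 // mulr_ge0.
exists B' => // a l0 ha fa la j l jm.
set k := `|a - w l0|^-1 in la *; set k1 := (1 + `|a|)^-1 in la *.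
have k0 : 0 <= k by rewrite invr_ge0.
have a1 : 0 < 1 + `|a| by rewrite ltr_wpDr.
have k10 : 0 <= k1 by rewrite invr_ge0 ltW.
have k11 : k1 <= 1 by rewrite invf_le1 // lerDl.
have kk1 : k * k1 <= k by rewrite ler_piMr.
have up x u t : 0 <= t -> u <= B' -> x <= u * t -> x <= B' * t.
  by move=> t0 uB /le_trans; apply; exact: ler_wpM2r.
have B'ge t rest : 0 <= rest -> B' = rest + t -> t <= B'.
  by move=> r0 ->; rewrite lerDr.
have PB0 : 0 <= P * B by exact: mulr_ge0.
have cP0 : 0 <= c * P * B by rewrite -mulrA mulr_ge0.
have cc0 : 0 <= c * c' by exact: mulr_ge0.
have B'1 : 1 <= B'.
  by apply: (B'ge _ (B + c + c * c' + P * B + c * P * B)); [rewrite !addr_ge0|rewrite /B'; ring].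
have B'c : c <= B'.
  by apply: (B'ge _ (B + 1 + c * c' + P * B + c * P * B)); [rewrite !addr_ge0|rewrite /B'; ring].
have B'cc : c * c' <= B'.
  by apply: (B'ge _ (B + 1 + c + P * B + c * P * B)); [rewrite !addr_ge0|rewrite /B'; ring].
have B'P : P * B <= B'.
  by apply: (B'ge _ (B + 1 + c + c * c' + c * P * B)); [rewrite !addr_ge0|rewrite /B'; ring].
have B'cP : c * P * B <= B'.
  by apply: (B'ge _ (B + 1 + c + c * c' + P * B)); [rewrite !addr_ge0|rewrite /B'; ring].
have IH (i : 'I_K) (ji : (j < i)%N) := IHm a l0 ha fa la i l
  (leq_trans jm (etrans (congr1 (fun e => e <= i + m)%N (addnS j m)) (leq_add ji (leqnn m)))).
have farj : j != l0 -> `|a - w j|^-1 <= c * k1 by exact: fa.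
have [jl|njl] := eqVneq j l.
  rewrite -jl res_cascade_diag // normrV ?unitfE //; have [->|nj] := eqVneq j l0.
    by split; [apply: (up _ _ _ k0 B'1); rewrite mul1r| |rewrite ltnn].
  split=> [|//|_]; last exact: up B'c (farj nj).
  by apply: (up _ _ _ k0 B'cc); apply: le_trans (farj nj) _; rewrite -mulrA ler_wpM2l.
have hj : `|res J a j l| = `|a - w j|^-1 *
   `|\sum_(m < K | (j < m)%N) (w m * (1 - theta m ^- 2)) * res J a m l|.
  have := res_cascadeE j l ha; rewrite (negbTE njl) add0r => <-.
  by rewrite normrM mulKf // normr_eq0.
have from2 : `|res J a j l| <= B' * (k * k1) -> `|res J a j l| <= B' * k.
  by move/le_trans; apply; rewrite ler_wpM2l.
have [jl0|nj] := eqVneq j l0.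
  have b2 : `|res J a j l| <= B' * (k * k1).
    apply: (up _ _ _ _ B'P); first exact: mulr_ge0.
    rewrite hj jl0 mulrCA ler_wpM2l // -jl0; apply: sum_bound => // i ji.
    by have [_ _] := IH i ji; apply; rewrite -jl0.
  by split=> //; [exact: from2|rewrite jl0 ltnn].
have b2 : `|res J a j l| <= B' * (k * k1).
  apply: (up _ _ _ _ B'cP); first exact: mulr_ge0.
  rewrite hj (_ : c * P * B * (k * k1) = (c * k1) * (P * B * k)); last by ring.
  apply: ler_pM; rewrite ?invr_ge0 //; first exact: farj.
  by apply: sum_bound => // i ji; case: (IH i ji).
split=> // [|l0j]; first exact: from2.
apply: (up _ _ _ _ B'cP) => //.
rewrite hj (_ : c * P * B * k1 = (c * k1) * (P * B * 1)); last by ring.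
apply: ler_pM; rewrite ?invr_ge0 //; first exact: farj.
apply: sum_bound => // i ji; case: (IH i ji) => _ _ /(_ (ltn_trans l0j ji)) /le_trans.
by apply; rewrite ler_wpM2l.
Qed.

Lemma le_normB (a b : C) : `|a - b| <= (1 + `|b|) * (1 + `|a|).
Proof.
apply: le_trans (ler_normB _ _) _.
rewrite (_ : (1 + _) * _ = `|a| + `|b| + (1 + `|b| * `|a|)); last by ring.
by rewrite lerDl addr_ge0 // mulr_ge0.
Qed.

Lemma res_cascade_bound d : 0 < d -> (0 < K)%N -> exists2 B, 0 <= B &
  forall a, (forall i, a - w i != 0) ->
  (forall j l, j != l -> d <= `|a - w j| \/ d <= `|a - w l|) ->
  exists l0, forall j l,
    `|res J a j l| <= B * `|a - w l0|^-1 /\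
    (j != l -> `|res J a j l| <= B * (`|a - w l0|^-1 / (1 + `|a|))).
Proof.
move=> d0 K0; pose c' := \sum_i (1 + `|w i|).
have w1 i : 0 <= 1 + `|w i| by rewrite addr_ge0.
have c'0 : 0 <= c' by apply: sumr_ge0.
have c'w i : 1 + `|w i| <= c' by rewrite /c' (bigD1 i) //= lerDl sumr_ge0.
pose c := 1 + c' / d.
have c0 : 0 <= c by rewrite addr_ge0 // divr_ge0 // ltW.
have [B B0 hB] := res_cascade_induct K c0 c'0; exists B => // a ha hd.
have a1 : 0 < 1 + `|a| by rewrite ltr_wpDr.
have hl l : d <= `|a - w l| -> `|a - w l|^-1 <= c / (1 + `|a|).
  move=> dl; have al : 0 < `|a - w l| by rewrite normr_gt0.
  rewrite ler_pdivlMr // mulrC ler_pdivrMr // /c mulrDl mul1r.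
  have : 1 + `|a| <= `|a - w l| + c'.
    rewrite -{1}(subrK (w l) a); apply: le_trans (lerD (lexx 1) (ler_normD _ _)) _.
    by rewrite addrCA lerD2l.
  move/le_trans; apply; rewrite lerD2l mulrAC ler_pdivlMr //.
  by rewrite ler_wpM2l.
have [l0 hl0] : exists l0, forall l, l != l0 -> d <= `|a - w l|.
  have [|/existsPn nl] := boolP [exists l, ~~ (d <= `|a - w l|)].
    case/existsP => l0 nl0; exists l0 => l ll0.
    by case: (hd _ _ ll0) => // h; rewrite h in nl0.
  by exists (Ordinal K0) => l _; have := nl l; rewrite negbK.
exists l0 => j l.
case: (hB a l0 ha _ _ j l) => //.
- by move=> i il0; apply/hl/hl0.
- rewrite ler_pdivlMr ?normr_gt0 // mulrC ler_pdivrMr //.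
  by apply: le_trans (le_normB _ _) _; rewrite ler_wpM2r // ltW.
- by rewrite leq_addl.
Qed.

End ResolventBound.

Section JointBound.
Variables (C : numFieldType) (N K : nat) (x r : 'I_N -> C) (w theta : 'I_K -> C).

Let Jx := cascade x r.
Let Jw := cascade w theta.

Lemma sub_mul_res n (J : 'M[C]_n) a b : a%:M - J \in unitmx ->
  (b%:M - J) *m res J a = 1%:M + (b - a) *: res J a.
Proof.
move=> ua; rewrite -(mulmxV ua) -/(res J a) -mul_scalar_mx -mulmxDl; congr (_ *m _).
by rewrite raddfB /= addrAC addrCA addrA addrK.
Qed.

Definition step y z : 'M[C]_N := (z%:M - Jx) *m res Jx y.
Definition costep y z : 'M[C]_K := res Jw z *m (y%:M - Jw).

Lemma joint_bound d C0 : 0 < d -> 0 <= C0 -> (0 < N)%N -> (0 < K)%N ->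
  exists2 B, 0 <= B & forall y z,
  (forall i, y - x i != 0) -> (forall j, z - w j != 0) ->
  (forall i l, i != l -> d <= `|y - x i| \/ d <= `|y - x l|) ->
  (forall j l, j != l -> d <= `|z - w j| \/ d <= `|z - w l|) ->
  (forall i j, `|z - y| * (`|y - x i|^-1 * `|z - w j|^-1) <= C0) ->
  [/\ forall i j i' j', (i, j) != (i', j') -> `|step y z i i'| * `|costep y z j j'| <= B,
      forall i, step y z i i = (z - x i) / (y - x i),
      forall j, costep y z j j = (y - w j) / (z - w j),
      forall i i' : 'I_N, (i' < i)%N -> step y z i i' = 0 &
      forall j j' : 'I_K, (j' < j)%N -> costep y z j j' = 0] /\
  forall i i' j j', `|z - y| * (`|res Jx y i i'| * `|res Jw z j j'|) <= B.
Proof.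
move=> d0 C00 N0 K0.
have [Bx Bx0 hBx] := res_cascade_bound x r d0 N0.
have [Bw Bw0 hBw] := res_cascade_bound w theta d0 K0.
pose cx := \sum_i (1 + `|x i|); pose cw := \sum_j (1 + `|w j|).
have x1 i : 0 <= 1 + `|x i| by rewrite addr_ge0.
have w1 j : 0 <= 1 + `|w j| by rewrite addr_ge0.
have cx0 : 0 <= cx by apply: sumr_ge0.
have cw0 : 0 <= cw by apply: sumr_ge0.
have cxi i : 1 + `|x i| <= cx by rewrite /cx (bigD1 i) //= lerDl sumr_ge0.
have cwj j : 1 + `|w j| <= cw by rewrite /cw (bigD1 j) //= lerDl sumr_ge0.
pose B := Bx * Bw * C0 + cw * Bx * C0 + cx * Bw * C0.
have [p1 p2 p3] : [/\ 0 <= Bx * Bw * C0, 0 <= cw * Bx * C0 & 0 <= cx * Bw * C0].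
  by rewrite !mulr_ge0.
exists B => [|y z hy hz dy dz hC]; first by rewrite !addr_ge0.
have uy : y%:M - Jx \in unitmx by rewrite unit_cascade_sub; apply/forallP.
have uz : z%:M - Jw \in unitmx by rewrite unit_cascade_sub; apply/forallP.
have [i0 hx] := hBx y hy dy; have [j0 hw] := hBw z hz dz.
have stepE i i' : step y z i i' = (i == i')%:R + (z - y) * res Jx y i i'.
  by rewrite /step sub_mul_res // !mxE.
have costepE j j' : costep y z j j' = (j == j')%:R + (y - z) * res Jw z j j'.
  by rewrite /costep -(comm_res y uz) sub_mul_res // !mxE.
have y1 : 0 < 1 + `|y| by rewrite ltr_wpDr.
have z1 : 0 < 1 + `|z| by rewrite ltr_wpDr.
have stepd i : step y z i i = (z - x i) / (y - x i).
  by rewrite stepE eqxx -[true%:R]/(1 : C) res_cascade_diag //; field; exact: hy.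
have costepd j : costep y z j j = (y - w j) / (z - w j).
  by rewrite costepE eqxx -[true%:R]/(1 : C) res_cascade_diag //; field; exact: hz.
split; [split=> //|].
- move=> i j i' j' ne.
  have so : i != i' -> `|step y z i i'| <= `|z - y| * (Bx * (`|y - x i0|^-1 / (1 + `|y|))).
    move=> ii; rewrite stepE (negbTE ii) add0r normrM ler_wpM2l //.
    by apply: (hx i i').2.
  have co : j != j' -> `|costep y z j j'| <= `|z - y| * (Bw * (`|z - w j0|^-1 / (1 + `|z|))).
    move=> jj; rewrite costepE (negbTE jj) add0r normrM distrC ler_wpM2l //.
    by apply: (hw j j').2.
  have [ei|ni] := eqVneq i i'.
    have nj : j != j' by apply: contraNneq ne => ->; rewrite ei.
    rewrite -ei stepd normrM normrV ?unitfE //.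
    apply: le_trans (_ : cx * Bw * C0 <= _); last by rewrite /B lerDr addr_ge0.
    apply: le_trans (ler_wpM2l _ (co nj)) _; first by rewrite mulr_ge0 ?invr_ge0.
    rewrite [leLHS](_ : _ = (`|z - x i| / (1 + `|z|)) * Bw *
      (`|z - y| * (`|y - x i|^-1 * `|z - w j0|^-1))); last by ring.
    apply: ler_pM; rewrite ?hC ?mulr_ge0 ?invr_ge0 ?(ltW y1) ?(ltW z1) //.
    rewrite ler_wpM2r // ler_pdivrMr //; apply: le_trans (le_normB _ _) _.
    by rewrite ler_wpM2r // ltW.
  have [ej|nj] := eqVneq j j'.
    rewrite -ej costepd normrM normrV ?unitfE //.
    apply: le_trans (_ : cw * Bx * C0 <= _); last by rewrite /B addrAC lerDr addr_ge0.
    apply: le_trans (ler_wpM2r _ (so ni)) _; first by rewrite mulr_ge0 ?invr_ge0.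
    rewrite [leLHS](_ : _ = (`|y - w j| / (1 + `|y|)) * Bx *
      (`|z - y| * (`|y - x i0|^-1 * `|z - w j|^-1))); last by ring.
    apply: ler_pM; rewrite ?hC ?mulr_ge0 ?invr_ge0 ?(ltW y1) ?(ltW z1) //.
    rewrite ler_wpM2r // ler_pdivrMr //; apply: le_trans (le_normB _ _) _.
    by rewrite ler_wpM2r // ltW.
  apply: le_trans (_ : Bx * Bw * C0 <= _); last by rewrite /B -addrA lerDl addr_ge0.
  apply: le_trans (ler_pM (normr_ge0 _) (normr_ge0 _) (so ni) (co nj)) _.
  rewrite [leLHS](_ : _ = (`|z - y| / ((1 + `|y|) * (1 + `|z|))) * (Bx * Bw *
    (`|z - y| * (`|y - x i0|^-1 * `|z - w j0|^-1)))); last by rewrite invfM; ring.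
  rewrite -[leRHS]mul1r; apply: ler_pM;
    rewrite ?mulr_ge0 ?invr_ge0 ?mulr_ge0 ?(ltW y1) ?(ltW z1) //.
  - rewrite ler_pdivrMr ?mulr_gt0 // mul1r; exact: le_normB.
  - by rewrite ler_wpM2l // mulr_ge0.
- by move=> i i' ii; rewrite stepE -val_eqE gtn_eqF // res_cascade_lower // mulr0 addr0.
- by move=> i i' ii; rewrite costepE -val_eqE gtn_eqF // res_cascade_lower // mulr0 addr0.
move=> i i' j j'.
apply: le_trans (_ : Bx * Bw * C0 <= _); last by rewrite /B -addrA lerDl addr_ge0.
apply: le_trans (ler_wpM2l (normr_ge0 _) (ler_pM (normr_ge0 _) (normr_ge0 _) (hx i i').1 (hw j j').1)) _.
rewrite [leLHS](_ : _ = Bx * Bw * (`|z - y| * (`|y - x i0|^-1 * `|z - w j0|^-1))); last by ring.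
by rewrite ler_wpM2l // mulr_ge0.
Qed.
End JointBound.

Section Contraction.
Variables (C : numFieldType) (T : finType) (h : T -> nat).

Definition contracting (rho B : C) (Q : T -> T -> C) (v v' : T -> C) :=
  [/\ forall t t', 0 <= Q t t', forall t, Q t t <= rho,
      forall t t', t != t' -> Q t t' <= B,
      forall t t', t != t' -> (h t < h t')%N \/ Q t t' = 0 &
      forall t', v' t' <= \sum_t v t * Q t t'].

Lemma weighted_contraction (rho B delta : C) Q v v' :
  0 <= delta -> delta <= 1 -> 0 <= rho -> 0 <= B ->
  contracting rho B Q v v' -> (forall t, 0 <= v t) ->
  \sum_t delta ^+ h t * v' t <=
  (rho + #|T|%:R * B * delta) * \sum_t delta ^+ h t * v t.
Proof.
move=> d0 d1 rho0 B0 [Q0 Qd QB Qh hv] v0.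
apply: le_trans (_ : \sum_t' delta ^+ h t' * \sum_t v t * Q t t' <= _).
  by apply: ler_sum => t _; rewrite ler_wpM2l // exprn_ge0.
under eq_bigr => t' _ do rewrite mulr_sumr.
rewrite exchange_big mulr_sumr /=; apply: ler_sum => t _.
rewrite (eq_bigr (fun t' => v t * (delta ^+ h t' * Q t t'))) => [|t' _]; last by rewrite mulrCA.
rewrite -mulr_sumr [leRHS]mulrA [leRHS]mulrC ler_wpM2l // [leRHS]mulrC mulrDr.
rewrite (bigD1 t) //= lerD //.
  by rewrite ler_wpM2l // exprn_ge0.
apply: le_trans (_ : \sum_(t' | t' != t) delta ^+ h t * (B * delta) <= _).
  apply: ler_sum => t' nt; rewrite eq_sym in nt.
  have [ht|->] := Qh _ _ nt; last by rewrite mulr0 !mulr_ge0 // exprn_ge0.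
  rewrite [B * _]mulrC mulrA -exprSr; apply: ler_pM => //; rewrite ?exprn_ge0 //.
    exact: ler_wiXn2l.
  exact: QB.
rewrite sumr_const -[leLHS]mulr_natl [leLHS]mulrCA ler_wpM2l ?exprn_ge0 // -mulrA.
rewrite ler_wpM2r ?mulr_ge0 // ler_nat; exact: max_card.
Qed.

Lemma geometric_decay (rho B : C) : 0 <= rho -> rho < 1 -> 0 <= B ->
  exists2 D, 0 <= D & forall (v : nat -> T -> C) (Q : nat -> T -> T -> C),
  (forall d t, 0 <= v d t) -> (forall d, contracting rho B (Q d) (v d) (v d.+1)) ->
  forall d t, v d t <= D * ((1 + rho) / 2) ^+ d * \sum_t v 0%N t.
Proof.
move=> rho0 rho1 B0; pose m := #|T|%:R * B.
have m0 : 0 <= m by rewrite mulr_ge0.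
pose delta := (1 - rho) / 2 / (m + 1).
have m1 : 0 < m + 1 by rewrite ltr_wpDl.
have d0 : 0 < delta by rewrite !divr_gt0 // subr_gt0.
have d1 : delta <= 1.
  rewrite ler_pdivrMr // mul1r ler_pdivrMr //; apply: le_trans (_ : 1 <= _).
    by rewrite lerBlDr lerDl.
  by rewrite mulrDl mul1r (@le_trans _ _ 2%:R) ?ler1n // lerDr mulr_ge0.
have hd : rho + m * delta <= (1 + rho) / 2.
  have -> : (1 + rho) / 2 = rho + (1 - rho) / 2 by field.
  rewrite lerD2l mulrC -mulrA ler_piMr //; first by rewrite divr_ge0 // subr_ge0 ltW.
  by rewrite mulrC ler_pdivrMr // mul1r lerDl.
exists (\sum_t (delta ^+ h t)^-1) => [|v Q v0 hQ d t].
  by apply: sumr_ge0 => t _; rewrite invr_ge0 exprn_ge0 // ltW.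
have s0 : 0 <= (1 + rho) / 2 by rewrite divr_ge0 // addr_ge0.
pose n d := \sum_t delta ^+ h t * v d t.
have n0 e : 0 <= n e by apply: sumr_ge0 => i _; rewrite mulr_ge0 // exprn_ge0 // ltW.
have nS e : n e <= ((1 + rho) / 2) ^+ e * n 0%N.
  elim: e => [|e IHe]; first by rewrite expr0 mul1r.
  apply: le_trans (weighted_contraction (ltW d0) d1 rho0 B0 (hQ e) (v0 e)) _.
  apply: le_trans (ler_wpM2r (n0 e) hd) _.
  by rewrite exprS -mulrA ler_wpM2l.
have vn : delta ^+ h t * v d t <= n d.
  rewrite /n (bigD1 t) //= lerDl; apply: sumr_ge0 => i _.
  by rewrite mulr_ge0 // exprn_ge0 // ltW.
have n0v : n 0%N <= \sum_t v 0%N t.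
  apply: ler_sum => i _; rewrite ler_piMl //; apply: exprn_ile1 => //; exact: ltW.
have dt0 : 0 < delta ^+ h t by rewrite exprn_gt0.
rewrite -(ler_pM2l dt0); apply: le_trans vn _; apply: le_trans (nS d) _.
rewrite (_ : _ * (_ * _) = (((1 + rho) / 2) ^+ d) * ((delta ^+ h t * \sum_t0 (delta ^+ h t0)^-1) *
  \sum_t0 v 0%N t0)); last by ring.
rewrite ler_wpM2l ?exprn_ge0 //; apply: le_trans n0v _.
rewrite ler_peMl ?sumr_ge0 // (bigD1 t) //= mulrDr mulfV ?gt_eqF //.
rewrite lerDl mulr_ge0 ?(ltW dt0) //; apply: sumr_ge0 => i _.
by rewrite invr_ge0 exprn_ge0 // ltW.
Qed.

End Contraction.

Section Decay.
Variables (C : numFieldType) (N K : nat) (x r : 'I_N -> C) (w theta : 'I_K -> C).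
Variables (y s : nat -> C) (d rho : C).
Hypotheses (N0 : (0 < N)%N) (K0 : (0 < K)%N) (d0 : 0 < d).
Hypotheses (rho0 : 0 <= rho) (rho1 : rho < 1).

Let z p := s p ^- 2 * y p.
Let Jx := cascade x r.
Let Jw := cascade w theta.

Hypothesis zw : forall p j, s p ^- 2 * y p - w j != 0.
Hypothesis yx : forall p i, y p - x i != 0.
Hypothesis xw : forall i j, x i != w j.
Hypothesis dy : forall p i l, i != l -> d <= `|y p - x i| \/ d <= `|y p - x l|.
Hypothesis dz : forall p j l, j != l ->
  d <= `|s p ^- 2 * y p - w j| \/ d <= `|s p ^- 2 * y p - w l|.
Hypothesis ratio : forall p i j, `|(s p ^- 2 * y p - x i) / (y p - x i) *
  ((y p - w j) / (s p ^- 2 * y p - w j))| <= rho.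

(* The ratio minus 1 is [(z - y) (x - w) / ((y - x) (z - w))]. *)
Let gap_bound : exists2 C0, 0 <= C0 & forall p i j,
  `|z p - y p| * (`|y p - x i|^-1 * `|z p - w j|^-1) <= C0.
Proof.
exists (\sum_i \sum_j (1 + 1) / `|x i - w j|).
  by apply: sumr_ge0 => i _; apply: sumr_ge0 => j _; rewrite divr_ge0 // addr_ge0.
move=> p i j.
apply: le_trans (_ : (1 + 1) / `|x i - w j| <= _); last first.
  rewrite (bigD1 i) //= (bigD1 j) //= -addrA lerDl addr_ge0 //.
    by apply: sumr_ge0 => l _; rewrite divr_ge0 // addr_ge0.
  apply: sumr_ge0 => k _; apply: sumr_ge0 => l _; by rewrite divr_ge0 // addr_ge0.
have xwij : 0 < `|x i - w j| by rewrite normr_gt0 subr_eq0.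
rewrite ler_pdivlMr // -!normfV -!normrM.
have -> : (z p - y p) * ((y p - x i)^-1 * (z p - w j)^-1) * (x i - w j) =
    (z p - x i) / (y p - x i) * ((y p - w j) / (z p - w j)) - 1.
  have := zw p j; rewrite -/(z p) => zwp; by field; rewrite zwp yx.
apply: le_trans (ler_normB _ _) _; rewrite normr1 lerD2r.
by apply: le_trans (ratio p i j) _; exact: ltW.
Qed.

Lemma hops_rec a e : hops w theta y s a e.+1 = hops w theta y s a e *m hop w theta y s (a + e).
Proof.
elim: e a => [|e IHe] a; first by rewrite /= mulmx1 mul1mx addn0.
by rewrite -[LHS]/(hop _ _ _ _ a *m hops _ _ _ _ a.+1 e.+1) IHe mulmxA addSnnS.
Qed.

Let sigma := (1 + rho) / 2.

Lemma joint_decay : exists2 B, 0 <= B & forall a, exists2 D, 0 <= D &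
  (forall e i i' j j', `|pimx Jx y z (a + e) i i'| * `|hops w theta y s a e j j'| <= D * sigma ^+ e) /\
  (forall p i i' j j', `|z p - y p| * (`|res Jx (y p) i i'| * `|res Jw (z p) j j'|) <= B).
Proof.
have [C0 C00 hC] := gap_bound.
have [B B0 hB] := joint_bound x r w theta d0 C00 N0 K0.
have hp p := hB (y p) (z p) (yx p) (zw p) (dy p) (dz p) (hC p).
exists B => // a.
pose T : finType := ('I_N * 'I_K)%type.
have [D D0 hD] := geometric_decay (fun t : T => t.1 + t.2)%N rho0 rho1 B0.
pose v i j e (t : T) := `|pimx Jx y z (a + e) i t.1| * `|hops w theta y s a e j t.2|.
pose Q e (t t' : T) := `|step x r (y (a + e)%N) (z (a + e)%N) t.1 t'.1| *
  `|costep w theta (y (a + e)%N) (z (a + e)%N) t.2 t'.2|.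
pose D' := D * \sum_i \sum_j \sum_t v i j 0%N t.
have v0 i j e t : 0 <= v i j e t by rewrite mulr_ge0.
have D'0 : 0 <= D'.
  by rewrite mulr_ge0 // sumr_ge0 // => i _; rewrite sumr_ge0 // => j _; rewrite sumr_ge0.
exists D' => //; split=> [e i i' j j'|p]; last by have [] := hp p.
have hv : v i j e (i', j') <= D * sigma ^+ e * \sum_t v i j 0%N t.
  apply: (hD (v i j) Q (v0 i j)) => {}e.
  have [[Bne dx dw lx lw] _] := hp (a + e)%N; split.
  - by move=> t t'; rewrite mulr_ge0.
  - by move=> [k l]; rewrite /Q dx dw -normrM; exact: ratio.
  - by move=> [k l] [k' l'] ne; exact: Bne.
  - move=> [k l] [k' l'] ne; rewrite /Q /=.
    have [kk|kk] := ltnP k' k; first by right; rewrite lx // normr0 mul0r.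
    have [ll|ll] := ltnP l' l; first by right; rewrite lw // normr0 mulr0.
    left; rewrite ltn_neqAle leq_add // andbT; apply: contra ne => /eqP e1.
    have [ek el] : k = k' /\ l = l' by split; apply: val_inj => /=; lia.
    by rewrite ek el.
  - move=> [k l]; rewrite /v addnS hops_rec /= -mulmxA -/(step x r _ _) !mxE.
    apply: le_trans (ler_pM (normr_ge0 _) (normr_ge0 _) (ler_norm_sum _ _ _) (ler_norm_sum _ _ _)) _.
    rewrite mulr_suml -(pair_big xpredT xpredT (fun k0 l0 => v i j e (k0, l0) * Q e (k0, l0) (k, l))) /=.
    apply: ler_sum => k0 _; rewrite mulr_sumr; apply: ler_sum => l0 _.
    by rewrite !normrM mulrACA.
apply: le_trans hv _; rewrite -mulrA [sigma ^+ _ * _]mulrC mulrA ler_wpM2r //.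
  by rewrite exprn_ge0 // divr_ge0 // addr_ge0.
rewrite ler_wpM2l //.
rewrite (bigD1 i) //= (bigD1 j) //= -addrA lerDl addr_ge0 //.
  by rewrite sumr_ge0 // => l _; rewrite sumr_ge0.
by rewrite sumr_ge0 // => k _; rewrite sumr_ge0 // => l _; rewrite sumr_ge0.
Qed.

Lemma pair_mulmx_bound (m n m' n' : nat) (c t B : C) (p : 'rV[C]_m) (S : 'M[C]_(m, n))
    (h : 'rV[C]_m') (R : 'M[C]_(m', n')) :
  0 <= t -> (forall i j, `|p 0 i| * `|h 0 j| <= c) ->
  (forall i l j k, t * (`|S i l| * `|R j k|) <= B) ->
  forall l k, t * (`|(p *m S) 0 l| * `|(h *m R) 0 k|) <= m%:R * m'%:R * c * B.
Proof.
move=> t0 hc hB l k; rewrite !mxE.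
apply: le_trans (ler_wpM2l t0 (ler_pM (normr_ge0 _) (normr_ge0 _)
  (ler_norm_sum _ _ _) (ler_norm_sum _ _ _))) _.
rewrite mulr_suml mulr_sumr.
apply: le_trans (_ : \sum_(i < m) \sum_(j < m') c * B <= _); last first.
  by rewrite !sumr_const !card_ord -!mulrA !mulr_natl.
apply: ler_sum => i _; rewrite mulr_sumr mulr_sumr; apply: ler_sum => j _.
rewrite !normrM (_ : t * _ = (`|p 0 i| * `|h 0 j|) * (t * (`|S i l| * `|R j k|))); last by ring.
by apply: ler_pM => //; rewrite !mulr_ge0.
Qed.

Lemma pair_rows_bound (m m' : nat) (c : C) (u : 'rV[C]_m) (P : 'M[C]_m)
    (g : 'rV[C]_m') (H : 'M[C]_m') :
  (forall i i' j j', `|P i i'| * `|H j j'| <= c) ->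
  forall i' j', `|(u *m P) 0 i'| * `|(g *m H) 0 j'| <=
    (\sum_i `|u 0 i|) * (\sum_j `|g 0 j|) * c.
Proof.
move=> hc i' j'; rewrite !mxE.
apply: le_trans (ler_pM (normr_ge0 _) (normr_ge0 _) (ler_norm_sum _ _ _) (ler_norm_sum _ _ _)) _.
rewrite !mulr_suml; apply: ler_sum => i _; rewrite mulr_sumr mulr_sumr mulr_suml.
apply: ler_sum => j _.
by rewrite !normrM mulrACA ler_wpM2l // mulr_ge0.
Qed.

Let sigma_gt0 : 0 < sigma.
Proof. by rewrite divr_gt0 // ltr_pwDl. Qed.

Lemma tau_decay (i : nat) (v : 'rV_N) : exists2 D, 0 <= D & forall q l,
  `|tau w theta y s i q| * `|(v *m phimx Jx y z q) 0 l| <= D * sigma ^+ q.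
Proof.
have [B B0 /(_ i.+1)[D D0 [hD hB]]] := joint_decay.
pose f q l := `|tau w theta y s i q| * `|(v *m phimx Jx y z q) 0 l|.
pose g := - (jump w theta *m res Jw (z i)).
pose c := (\sum_i `|v 0 i|) * (\sum_j `|g 0 j|).
have c0 : 0 <= c by rewrite mulr_ge0 // sumr_ge0.
pose D1 := \sum_(q < i.+1) \sum_l f q l / sigma ^+ q.
pose D2 := K%:R * (N%:R * K%:R * (c * D / sigma ^+ i.+1) * B).
have f0 q l : 0 <= f q l / sigma ^+ q.
  by rewrite /f divr_ge0 ?mulr_ge0 // exprn_ge0 ?(ltW sigma_gt0).
have D10 : 0 <= D1 by apply: sumr_ge0 => q _; apply: sumr_ge0.
have D20 : 0 <= D2.
  have cD : 0 <= c * D / sigma ^+ i.+1 by rewrite divr_ge0 ?exprn_ge0 ?(ltW sigma_gt0) ?(mulr_ge0 c0 D0).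
  by rewrite /D2 mulr_ge0 // mulr_ge0 // mulr_ge0 // mulr_ge0.
exists (D1 + D2) => [|q l]; first exact: addr_ge0.
have sq : 0 < sigma ^+ q by rewrite exprn_gt0.
rewrite mulrDl; have [qi|iq] := ltnP q i.+1.
  rewrite -[leLHS]addr0 lerD //; last by rewrite mulr_ge0 // ltW.
  rewrite -ler_pdivrMr // /D1 (bigD1 (Ordinal qi)) //= (bigD1 l) //= -addrA lerDl addr_ge0 //.
    by apply: sumr_ge0 => l' _; exact: f0.
  by apply: sumr_ge0 => q' _; apply: sumr_ge0 => l' _; exact: f0.
rewrite -[leLHS]add0r lerD //; first by rewrite mulr_ge0 // ltW.
have qE : q = (i.+1 + (q - i.+1))%N by rewrite subnKC.
set e := (q - i.+1)%N in qE.
have tauE : tau w theta y s i q =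
    (z q - y q) * \sum_k (g *m hops w theta y s i.+1 e *m res Jw (z q)) 0 k.
  rewrite /tau /reach iq ltn_eqF // scale0r sub0r add0r mulmxN mulmxN mulmxA -mulNmx -/g.
  rewrite /turn_up -!scalemxAr mxE; congr (_ * _); rewrite !mulmxA -/e.
  by rewrite mxE; apply: eq_bigr => k _; rewrite [ones _ _ _ _]mxE mulr1.
have pq : forall i' j', `|(v *m pimx Jx y z q) 0 i'| *
    `|(g *m hops w theta y s i.+1 e) 0 j'| <= c * D / sigma ^+ i.+1 * sigma ^+ q.
  move=> i' j'; apply: le_trans (pair_rows_bound v g (c := D * sigma ^+ e) _ i' j') _.
    by move=> ? ? ? ?; rewrite qE; exact: hD.
  rewrite -/c qE exprD !mulrA mulfVK ?gt_eqF ?exprn_gt0 //.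
rewrite tauE normrM.
apply: le_trans (_ : \sum_(k < K) N%:R * K%:R * (c * D / sigma ^+ i.+1 * sigma ^+ q) * B <= _).
  apply: le_trans (ler_wpM2r _ (ler_wpM2l _ (ler_norm_sum _ _ _))) _ => //.
  rewrite mulr_sumr mulr_suml; apply: ler_sum => k _; rewrite -mulrA [X in _ * X]mulrC.
  rewrite /phimx mulmxA.
  apply: (pair_mulmx_bound (normr_ge0 _) pq) => ? ? ? ?; exact: hB.
rewrite sumr_const card_ord -[leLHS]mulr_natl /D2 le_eqVlt; apply/orP; left; apply/eqP; ring.
Qed.

Lemma truncated_decay (i : nat) (v' : 'rV_N) (Y : 'M[C]_(K, N)) : exists2 D, 0 <= D &
  forall M l, (i < M)%N ->
  `|truncated w theta y s Jx v' Y M i 0 l - (v' *m phimx Jx y z i) 0 l| <= D * sigma ^+ M.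
Proof.
have [B B0 /(_ i.+1)[D D0 [hD _]]] := joint_decay.
pose g := jump w theta *m res Jw (z i).
have s0 n : 0 < sigma ^+ n by rewrite exprn_gt0.
exists ((\sum_j \sum_i `|Y j i|) * ((\sum_j `|g 0 j|) * (D / sigma ^+ i.+1))) => [|M l iM].
  rewrite mulr_ge0 //; first by apply: sumr_ge0 => j _; exact: sumr_ge0.
  by rewrite mulr_ge0 ?sumr_ge0 // divr_ge0 // ltW.
have ME : M = (i.+1 + (M - i.+1))%N by rewrite subnKC.
rewrite mxE addrAC subrr add0r !mulmxA -/g; set e := (M - i.+1)%N in ME *.
have gh j i' : `|(g *m hops w theta y s i.+1 e) 0 j| * `|pimx Jx y z M i' l| <=
    (\sum_j `|g 0 j|) * (D / sigma ^+ i.+1) * sigma ^+ M.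
  rewrite [in leRHS]ME exprD !mulrA mulfVK ?gt_eqF // mxE.
  apply: le_trans (ler_wpM2r (normr_ge0 _) (ler_norm_sum _ _ _)) _.
  rewrite -mulrA !mulr_suml; apply: ler_sum => k _.
  by rewrite normrM -mulrA ler_wpM2l // mulrC ME; exact: hD.
rewrite mxE; apply: le_trans (ler_norm_sum _ _ _) _.
apply: le_trans (_ : \sum_i' \sum_j `|Y j i'| * ((\sum_j `|g 0 j|) * (D / sigma ^+ i.+1) * sigma ^+ M) <= _).
  apply: ler_sum => i' _; rewrite mxE mulr_suml.
  apply: le_trans (ler_norm_sum _ _ _) _; apply: ler_sum => j _.
  by rewrite !normrM -[leLHS]mulrA [leLHS]mulrCA ler_wpM2l.
rewrite -[leRHS]mulrA [leLHS]exchange_big [leRHS]mulr_suml /=; apply: ler_sum => j _.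
by rewrite [leRHS]mulr_suml.
Qed.

End Decay.

(** * Summation over signatures *)

Section DetBounds.
Variable C : numFieldType.

Lemma det_mul_bound n (A B : 'M[C]_n) (b : 'I_n -> C) :
  (forall i j l, `|A i j| * `|B j l| <= b j) ->
  `|\det A * \det B| <= (#|{perm 'I_n}|%:R) ^+ 2 * \prod_j b j.
Proof.
move=> hb; rewrite -[\det A]det_tr normrM /determinant.
apply: le_trans (ler_pM (normr_ge0 _) (normr_ge0 _) (ler_norm_sum _ _ _) (ler_norm_sum _ _ _)) _.
rewrite mulr_suml; apply: le_trans (_ : \sum_(s : {perm 'I_n}) \sum_(t : {perm 'I_n}) \prod_j b j <= _).
  apply: ler_sum => s _; rewrite mulr_sumr; apply: ler_sum => t _.
  rewrite !normrM !normrX !normrN1 !expr1n !mul1r !normr_prod -big_split /=.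
  by apply: ler_prod => j _; rewrite mulr_ge0 //= mxE hb.
by rewrite !sumr_const expr2 -mulrA !mulr_natl.
Qed.

Lemma prod_near (I : Type) (q : seq I) (a b : I -> C) (k e : C) :
  1 <= k -> 0 <= e -> (forall i, `|a i| <= k) -> (forall i, `|b i| <= k) ->
  (forall i, `|a i - b i| <= e) ->
  `|\prod_(i <- q) a i - \prod_(i <- q) b i| <= (size q)%:R * k ^+ size q * e.
Proof.
move=> k1 e0 ha hb hab; have k0 : 0 <= k by apply: le_trans k1.
elim: q => [|i q IHq]; first by rewrite !big_nil subrr normr0 !mul0r.
rewrite !big_cons.
have -> : a i * \prod_(j <- q) a j - b i * \prod_(j <- q) b j =
   a i * (\prod_(j <- q) a j - \prod_(j <- q) b j) + (a i - b i) * \prod_(j <- q) b j by ring.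
apply: le_trans (ler_normD _ _) _; rewrite !normrM /=.
rewrite -addn1 natrD mulrDl mulrDl; apply: lerD.
  rewrite addn1 exprS (_ : _ * e = k * ((size q)%:R * k ^+ size q * e)); last by ring.
  exact: ler_pM.
rewrite mul1r [leRHS]mulrC; apply: ler_pM => //.
apply: le_trans (_ : k ^+ size q <= _); last first.
  by rewrite addn1 exprS ler_peMl // exprn_ge0.
rewrite normr_prod; elim: (q) => [|j s IHs]; first by rewrite big_nil.
by rewrite big_cons exprS; apply: ler_pM => //; rewrite prodr_ge0.
Qed.

Lemma det_near n (A0 : 'M[C]_n) E : 0 <= E -> exists2 L, 0 <= L & forall (A : 'M[C]_n) e,
  0 <= e -> e <= E -> (forall i j, `|A i j - A0 i j| <= e) ->
  `|\det A - \det A0| <= L * e.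
Proof.
move=> E0; pose k := 1 + E + \sum_i \sum_j `|A0 i j|.
have sA0 : 0 <= \sum_i \sum_j `|A0 i j| by apply: sumr_ge0 => i _; exact: sumr_ge0.
have k1 : 1 <= k by rewrite /k -addrA lerDl addr_ge0.
have k0 : 0 <= k by apply: le_trans k1.
have A0k i j : `|A0 i j| <= \sum_i \sum_j `|A0 i j|.
  rewrite (bigD1 i) //= (bigD1 j) //= -addrA lerDl addr_ge0 ?sumr_ge0 //.
  by move=> l _; exact: sumr_ge0.
exists (#|{perm 'I_n}|%:R * (n%:R * k ^+ n)) => [|A e e0 e1 hA].
  by rewrite !mulr_ge0 // exprn_ge0.
rewrite /determinant -sumrB; apply: le_trans (ler_norm_sum _ _ _) _.
apply: le_trans (_ : \sum_(s : {perm 'I_n}) n%:R * k ^+ n * e <= _); last first.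
  by rewrite sumr_const -[leRHS]mulrA [leRHS]mulr_natl.
apply: ler_sum => s _; rewrite -mulrBr normrM normrX normrN1 expr1n mul1r.
have := @prod_near _ (index_enum 'I_n) (fun i => A i (s i)) (fun i => A0 i (s i)) k e k1 e0.
rewrite -[index_enum _]enumT size_enum_ord; apply => i.
- rewrite -[A i (s i)](subrK (A0 i (s i))); apply: le_trans (ler_normD _ _) _.
  by apply: lerD; [apply: le_trans (hA _ _) (le_trans e1 _); rewrite lerDr|exact: A0k].
- by apply: le_trans (A0k _ _) _; rewrite lerDr addr_ge0.
- exact: hA.
Qed.

End DetBounds.

Section Signatures.
Variable N : nat.

Lemma signature_eq (lam mu : signature N) : part_pos lam =1 part_pos mu -> lam = mu.
Proof.
move=> e; apply/val_inj/eq_from_tnth => j.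
by have := e j; rewrite /part_pos => /addIn.
Qed.

Definition bounded_signatures M : {fset signature N} :=
  [fset lam in pmap insub [seq map_tuple val t | t <- enum {: N.-tuple 'I_M}] |
     [forall j, (part_pos lam j < M)%N]]%fset.

Lemma mem_bounded_signatures M lam :
  (lam \in bounded_signatures M) = [forall j, (part_pos lam j < M)%N].
Proof.
rewrite !inE /=; apply: andb_idl => /forallP posM.
rewrite mem_pmap_sub; apply/mapP.
have tM j : (tnth (val lam) j < M)%N by apply: leq_ltn_trans (leq_addr _ _) (posM j).
exists [tuple Ordinal (tM j) | j < N]; first by rewrite mem_enum.
by apply: eq_from_tnth => j; rewrite tnth_map tnth_mktuple.
Qed.

Lemma signature_of_positions (t : seq nat) : size t = N -> sorted gtn t ->
  exists lam : signature N, [seq part_pos lam j | j <- enum 'I_N] = t.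
Proof.
move=> szt srt.
have dec j : (j.+1 < N)%N -> (nth 0 t j.+1 < nth 0 t j)%N.
  by move=> jN; have /(sortedP 0%N) := srt; apply; rewrite szt.
have low d j : (j + d.+1 = N)%N -> (d <= nth 0 t j)%N.
  elim: d j => [//|d IHd] j jd; apply: leq_ltn_trans (IHd j.+1 _) (dec j _); lia.
pose u := [tuple (nth 0 t j - (N - j.+1))%N | j < N].
have nthu j (jN : (j < N)%N) : nth 0 u j = (nth 0 t j - (N - j.+1))%N.
  by rewrite -[j]/(val (Ordinal jN)) -tnth_nth tnth_mktuple.
have su : sorted geq u.
  apply/(sortedP 0%N) => j; rewrite size_tuple => jN; rewrite /= !nthu // ?(ltnW jN) //.
  by have := dec j jN; lia.
exists (exist _ u su); apply: (@eq_from_nth _ 0%N) => [|j]; rewrite size_map size_enum_ord // => jN.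
rewrite (nth_map (Ordinal jN)) ?size_enum_ord // /part_pos /= tnth_mktuple nth_enum_ord // subnK //.
by apply: low; lia.
Qed.

Lemma sum_bounded_signatures (C : nmodType) M (f : M.-tuple bool -> C) :
  (forall S : M.-tuple bool, count id S != N -> f S = 0) ->
  \sum_(lam <- bounded_signatures M) f (tuple_of_pred M (part_set lam)) = \sum_S f S.
Proof.
move=> f0; pose phi (lam : signature N) := tuple_of_pred M (part_set lam).
rewrite -(big_map phi xpredT f).
rewrite [RHS](bigID (fun S => S \in [seq phi lam | lam <- bounded_signatures M])) /=.
rewrite [X in _ = _ + X]big1 ?addr0 => [|S nS]; last first.
  apply: f0; apply: contra nS => /eqP cS.
  pose t := rev [seq i <- iota 0 M | nth false S i].
  have szt : size t = N.
    rewrite size_rev size_filter -cS; have -> : (S : seq bool) = mkseq (nth false S) M.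
      by apply: etrans (esym (mkseq_nth false S)) _; rewrite size_tuple.
    by rewrite /mkseq count_map; apply: eq_in_count => i; rewrite mem_iota => ?; rewrite /= nth_mkseq.
  have srt : sorted gtn t.
    by rewrite rev_sorted; exact: (sorted_filter ltn_trans) (iota_ltn_sorted 0 M).
  have [lam tE] := signature_of_positions szt srt.
  apply/mapP; exists lam.
    rewrite mem_bounded_signatures; apply/forallP => j.
    have : part_pos lam j \in t by rewrite -tE map_f // mem_enum.
    by rewrite mem_rev mem_filter mem_iota => /andP[_].
  apply: eq_from_tnth => i; rewrite tnth_mktuple part_setE tE mem_rev mem_filter mem_iota.
  by rewrite ltn_ord /= andbT (tnth_nth false).
rewrite [RHS]big_mkcond -[RHS]big_mkcond -big_uniq //.
rewrite map_inj_in_uniq ?fset_uniq // => lam mu.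
rewrite !mem_bounded_signatures => /forallP hl /forallP hm e.
apply: signature_eq => j.
have : [seq part_pos lam j | j <- enum 'I_N] = [seq part_pos mu j | j <- enum 'I_N].
  apply: (can_inj revK); rewrite -(filter_part_set hl) -(filter_part_set hm).
  apply: eq_in_filter => i; rewrite mem_iota add0n /= => iM.
  by have := congr1 (fun S => tnth S (Ordinal iM)) e; rewrite !tnth_mktuple.
by move/eq_in_map => /(_ j); rewrite mem_enum; apply.
Qed.

Lemma sum_signatures_le (C : numFieldType) (t : C) (J : {fset signature N}) :
  0 <= t -> t < 1 ->
  \sum_(lam <- J) \prod_j t ^+ part_pos lam j <= (1 - t)^-1 ^+ N.
Proof.
move=> t0 t1; have t1' : 0 < 1 - t by rewrite subr_gt0.
pose M := (\sum_(lam <- J) \sum_j part_pos lam j).+1.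
have posM lam j : lam \in J -> (part_pos lam j < M)%N.
  by move=> lJ; rewrite ltnS (big_rem lam) //= (bigD1 j) //= -addnA leq_addr.
pose phi (lam : signature N) : {ffun 'I_N -> 'I_M} := [ffun j => inord (part_pos lam j)].
pose h (f : {ffun 'I_N -> 'I_M}) := \prod_j t ^+ f j.
have h0 f : 0 <= h f by apply: prodr_ge0 => j _; exact: exprn_ge0.
have phiE lam j : lam \in J -> phi lam j = part_pos lam j :> nat.
  by move=> lJ; rewrite ffunE inordK // posM.
rewrite (eq_big_seq (fun lam => h (phi lam))) => [|lam lJ]; last first.
  by apply: eq_bigr => j _; rewrite phiE.
rewrite -(big_map phi xpredT h) big_uniq ?map_inj_in_uniq ?fset_uniq //=; last first.
  move=> lam mu lJ mJ e; apply: signature_eq => j.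
  by rewrite -(phiE lam) // -(phiE mu) // e.
apply: le_trans (_ : \sum_f h f <= _).
  by rewrite big_mkcond; apply: ler_sum => f _; case: ifP.
rewrite /h -(bigA_distr_bigA (fun _ (q : 'I_M) => t ^+ q)) prodr_const card_ord.
apply: lerXn2r; rewrite ?nnegrE ?invr_ge0 ?(ltW t1') //.
  by apply: sumr_ge0 => q _; exact: exprn_ge0.
rewrite -[leRHS]mul1r ler_pdivlMr // mulrC -opprB mulNr -subrX1 opprB.
by rewrite lerBlDr lerDl exprn_ge0.
Qed.

End Signatures.

Section Estimate.
Variables (C : numFieldType) (N k : nat).
Variables (x r : 'I_N -> C) (w theta : 'I_k -> C) (y s : nat -> C) (d rho : C).
Hypotheses (N0 : (0 < N)%N) (k0 : (0 < k)%N) (d0 : 0 < d).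
Hypotheses (rho0 : 0 <= rho) (rho1 : rho < 1).
Hypothesis zx : forall p i, s p ^- 2 * y p - x i != 0.
Hypothesis zw : forall p j, s p ^- 2 * y p - w j != 0.
Hypothesis yx : forall p i, y p - x i != 0.
Hypothesis xw : forall i j, x i != w j.
Hypothesis dy : forall p i l, i != l -> d <= `|y p - x i| \/ d <= `|y p - x l|.
Hypothesis dz : forall p j l, j != l ->
  d <= `|s p ^- 2 * y p - w j| \/ d <= `|s p ^- 2 * y p - w l|.
Hypothesis ratio : forall p i j, `|(s p ^- 2 * y p - x i) / (y p - x i) *
  ((y p - w j) / (s p ^- 2 * y p - w j))| <= rho.

Let z p := s p ^- 2 * y p.
Let Jx := cascade x r.
Let X q := - jump x r *m phimx Jx y z q.
Let sigma := (1 + rho) / 2.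
Let GF (lam : signature N) := G lam w y theta s * F lam x y r s.

Definition cauchy_value : C :=
  ((\prod_(i < N) \prod_(j < N | (i <= j)%N) (r i ^- 2 * x i - x j)) *
   (\prod_(i < N) \prod_(j < N | (i < j)%N) (s i ^- 2 * y i - y j)) /
   (\prod_(i < N) \prod_(j < N) (y i - x j)) *
   \prod_(i < N) \prod_(j < k) ((x i - theta j ^- 2 * w j) / (x i - w j))).

Let sigma0 : 0 <= sigma.
Proof. by rewrite divr_ge0 // addr_ge0. Qed.

Let sigma1 : sigma < 1.
Proof. by rewrite ltr_pdivrMr // mul1r ltrD2l. Qed.

Let F_det_pos lam : F lam x y r s = \det (\matrix_j X (part_pos lam j)).
Proof.
pose M := (\sum_j part_pos lam j).+1.
have posM j : (part_pos lam j < M)%N by rewrite ltnS (bigD1 j) //= leq_addr.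
rewrite (F_det (M := M) r _ zx yx) ?rdet_part_set //.
by move=> i; rewrite part_setE => /mapP[j _ ->].
Qed.

Lemma term_bound : exists2 A, 0 <= A & forall lam,
  `|GF lam| <= A * \prod_j sigma ^+ part_pos lam j.
Proof.
have h (i : 'I_N) := tau_decay r theta N0 k0 d0 rho0 rho1 zw yx xw dy dz ratio
  (N - i.+1)%N (- jump x r).
have [D D0 hD] : exists2 D, 0 <= D & forall (i : 'I_N) q l,
    `|tau w theta y s (N - i.+1)%N q| * `|X q 0 l| <= D * sigma ^+ q.
  have [f f0 hf] := fin_all_exists2 h.
  exists (\sum_i f i) => [|i q l]; first exact: sumr_ge0.
  apply: le_trans (hf i q l) _; rewrite ler_wpM2r ?exprn_ge0 //.
  by rewrite (bigD1 i) //= lerDl sumr_ge0.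
exists (#|{perm 'I_N}|%:R ^+ 2 * D ^+ N) => [|lam].
  by rewrite mulr_ge0 ?exprn_ge0.
rewrite /GF G_det // F_det_pos.
apply: le_trans (det_mul_bound (b := fun j => D * sigma ^+ part_pos lam j) _) _.
  by move=> i j l; rewrite mxE [(\matrix_j0 _) j l]mxE; exact: hD.
by rewrite big_split /= prodr_const card_ord mulrA.
Qed.

Lemma truncated_bound : exists2 A, 0 <= A & forall M, (N <= M)%N ->
  `|\sum_(lam <- bounded_signatures N M) GF lam - cauchy_value| <= A * sigma ^+ M.
Proof.
have uw j : (w j)%:M - Jx \in unitmx.
  by rewrite unit_cascade_sub; apply/forallP => i; rewrite subr_eq0 eq_sym.
have uy p : (y p)%:M - Jx \in unitmx by rewrite unit_cascade_sub; apply/forallP.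
have [Y [g [syl vE cg dg]]] := sylvester_solution (- jump x r) theta uw.
pose A0 : 'M[C]_N := \matrix_(i < N) (- jump x r *m g *m phimx Jx y z (N - i.+1)%N).
have detA0 : \det A0 = cauchy_value.
  have -> : A0 = (\matrix_(i < N) X (N - i.+1)%N) *m g.
    apply/row_matrixP => i; rewrite row_mul !rowK -[LHS]mulmxA.
    by rewrite (comm_phimx _ _ uy cg) [LHS]mulmxA.
  rewrite det_mulmx /X det_phi // dg /cauchy_value; congr (_ * _).
  rewrite exchange_big; apply: eq_bigr => j _ /=; rewrite !det_cascade_sub -prodf_div.
  by apply: eq_bigr => i _; rewrite -opprB -[w j - x i]opprB invrN mulrNN.
have h (i : 'I_N) := truncated_decay r theta N0 k0 d0 rho0 rho1 zw yx xw dy dz ratio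
  (N - i.+1)%N (- jump x r *m g) Y.
have [D D0 hD] : exists2 D, 0 <= D & forall (i : 'I_N) M l, (N <= M)%N ->
    `|truncated w theta y s Jx (- jump x r *m g) Y M (N - i.+1)%N 0 l - A0 i l| <= D * sigma ^+ M.
  have [f f0 hf] := fin_all_exists2 h.
  exists (\sum_i f i) => [|i M l NM]; first exact: sumr_ge0.
  rewrite [A0 i l]mxE; apply: le_trans (hf i M l _) _.
    by move: (ltn_ord i); lia.
  rewrite ler_wpM2r ?exprn_ge0 // (bigD1 i) //= lerDl sumr_ge0 //.
have [L L0 hL] := det_near A0 D0.
have sumE M : (N <= M)%N -> \sum_(lam <- bounded_signatures N M) GF lam =
    \det (\matrix_(i < N) truncated w theta y s Jx (- jump x r *m g) Y M (N - i.+1)%N).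
  move=> NM; rewrite -(rdet_initial (truncated w theta y s Jx (- jump x r *m g) Y M) NM).
  rewrite -(truncated_sum zw (v := - jump x r) uy syl vE _ (@alternating_rdet C N)).
  rewrite -(@sum_bounded_signatures N) => [|S nS]; last by rewrite rdet_size ?mulr0 // size_sel.
  apply: eq_big_seq => lam; rewrite mem_bounded_signatures => /forallP posM.
  have partM i : part_set lam i -> (i < M)%N by rewrite part_setE => /mapP[j _ ->].
  by rewrite /GF (G_chain w theta y s NM partM) (F_det r partM zx yx).
exists (L * D) => [|M NM]; first exact: mulr_ge0.
rewrite sumE // -detA0 -mulrA; apply: hL => [||i j].
- by rewrite mulr_ge0 // exprn_ge0.
- by rewrite ler_piMr // exprn_ile1 // ltW.
- by rewrite mxE; exact: hD.
Qed.

Let tau := (1 + sigma) / 2.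

Lemma cauchy_estimate : exists A t, [/\ 0 <= A, 0 <= t, t < 1 &
  forall M (J : {fset signature N}), (N <= M)%N -> (bounded_signatures N M `<=` J)%fset ->
  `|\sum_(lam <- J) GF lam - cauchy_value| <= A * t ^+ M].
Proof.
have [A1 A10 h1] := term_bound; have [A2 A20 h2] := truncated_bound.
have t0 : 0 <= tau by rewrite divr_ge0 // addr_ge0.
have t1 : tau < 1 by rewrite ltr_pdivrMr // mul1r ltrD2l.
have st : sigma <= tau.
  by rewrite ler_pdivlMr // mulr_natr mulr2n lerD2r ltW.
have st2 : sigma <= tau ^+ 2.
  rewrite -subr_ge0 (_ : _ - _ = ((1 - sigma) / 2) ^+ 2); last by rewrite /tau; field.
  by rewrite exprn_ge0 // divr_ge0 // subr_ge0 ltW.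
pose P := (1 - tau)^-1 ^+ N.
have P0 : 0 <= P by rewrite exprn_ge0 // invr_ge0 subr_ge0 ltW.
exists (A1 * P + A2), tau; split=> //; first by rewrite addr_ge0 // mulr_ge0.
move=> M J NM sub; rewrite (big_fsetID _ (mem (bounded_signatures N M))) /=.
set S1 := \sum_(_ <- _) _; set S2 := \sum_(_ <- _) _.
have -> : S1 = \sum_(lam <- bounded_signatures N M) GF lam.
  apply: eq_fbigl; move: (bounded_signatures N M) sub {S1 S2} => Bd sub lam.
  by rewrite !inE /=; apply: andb_idl; exact: (fsubsetP sub).
rewrite addrAC addrC mulrDl; apply: le_trans (ler_normD _ _) _; apply: lerD; last first.
  apply: le_trans (h2 M NM) _; rewrite ler_wpM2l //.
  by apply: lerXn2r; rewrite ?nnegrE.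
apply: le_trans (ler_norm_sum _ _ _) _.
rewrite -mulrA [P * _]mulrC mulrA.
apply: le_trans (ler_wpM2l _ (sum_signatures_le _ t0 t1)); last by rewrite mulr_ge0 // exprn_ge0.
rewrite mulr_sumr big_seq [leRHS]big_seq; apply: ler_sum => lam.
have -> : (lam \in [fset lam in J | lam \notin mem (bounded_signatures N M)]%fset) =
    (lam \in J) && (lam \notin bounded_signatures N M).
  by move: (bounded_signatures N M) => Bd; rewrite !inE.
case/andP => _; rewrite mem_bounded_signatures negb_forall => /existsP[j]; rewrite -leqNgt => Mj.
apply: le_trans (h1 lam) _; rewrite -mulrA ler_wpM2l //.
apply: le_trans (_ : \prod_j (tau ^+ part_pos lam j * tau ^+ part_pos lam j) <= _).
  apply: ler_prod => i _; rewrite exprn_ge0 //= -exprMn -expr2.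
  by apply: lerXn2r; rewrite ?nnegrE ?exprn_ge0.
rewrite big_split /= ler_wpM2r ?prodr_ge0 // => [i _|]; first exact: exprn_ge0.
apply: le_trans (_ : tau ^+ part_pos lam j <= _); last by apply: ler_wiXn2l => //; exact: ltW.
rewrite (bigD1 j) //= ler_piMr ?exprn_ge0 //; apply: prodr_ile1 => i _.
by rewrite exprn_ge0 //= exprn_ile1 // ltW.
Qed.

End Estimate.

Lemma uniform_pos (C : numFieldType) (T : finType) (P : T -> C -> Prop) :
  (forall t, exists2 d, 0 < d & P t d) ->
  (forall t d d', d' <= d -> P t d -> P t d') ->
  exists2 d, 0 < d & forall t, P t d.
Proof.
move=> hP mP; have [f f0 hf] := fin_all_exists2 hP.
have S0 : 0 <= \sum_t (f t)^-1 by apply: sumr_ge0 => t _; rewrite invr_ge0 ltW.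
have S1 : 0 < 1 + \sum_t (f t)^-1 by rewrite ltr_wpDr.
exists (1 + \sum_t (f t)^-1)^-1 => [|t]; first by rewrite invr_gt0.
apply: mP (hf t); rewrite -[f t]invrK lef_pV2 ?posrE ?invr_gt0 //.
rewrite (bigD1 t) //= addrCA lerDl addr_ge0 //; apply: sumr_ge0 => i _.
by rewrite invr_ge0 ltW.
Qed.

Section Complex.
Variable R : realType.
Implicit Types z : R[i].

Lemma normC_cabs z : `|z| = (cabs z)%:C%C.
Proof. by rewrite RRe_real // normr_real. Qed.

Lemma separated (n : nat) (x : 'I_n -> R[i]) (y : nat -> R[i]) :
  (forall i l, i != l -> x i = x l ->
     exists2 delta : R, 0 < delta & forall p, delta <= cabs (y p - x i)) ->
  exists2 d : R[i], 0 < d & forall i l, i != l ->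
    forall p, d <= `|y p - x i| \/ d <= `|y p - x l|.
Proof.
move=> far.
have [||d d0 hd] := @uniform_pos R[i] ('I_n * 'I_n)%type
  (fun il d => il.1 != il.2 -> forall p, d <= `|y p - x il.1| \/ d <= `|y p - x il.2|).
- move=> [i l] /=; have [->|il] := eqVneq i l; first by exists 1.
  have [xil|nx] := eqVneq (x i) (x l).
    have [delta delta0 h] := far i l il xil; exists delta%:C%C; first by rewrite ltcR.
    by move=> _ p; left; rewrite normC_cabs lecR.
  have n0 : 0 < `|x i - x l| by rewrite normr_gt0 subr_eq0.
  exists (`|x i - x l| / 2) => [|_ p]; first by rewrite divr_gt0.
  case: (real_leP (_ : `|x i - x l| / 2 \is Num.real) (normr_real (y p - x i))).
  - by rewrite realM ?realV ?normr_real ?realn.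
  - by left.
  move=> lt1; right; rewrite -(lerD2l (`|x i - x l| / 2)) -splitr.
  apply: le_trans (_ : `|y p - x i| + `|y p - x l| <= _); last by rewrite lerD2r ltW.
  rewrite (_ : x i - x l = (y p - x l) - (y p - x i)); last by ring.
  by rewrite [leRHS]addrC; exact: ler_normB.
- by move=> [i l] e e' ee h il p; case: (h il p) => /(le_trans ee); [left|right].
by exists d => // i l il p; exact: (hd (i, l) il p).
Qed.

Lemma exp_small (A t e : R[i]) (N : nat) : 0 <= A -> 0 <= t -> t < 1 -> 0 < e ->
  exists2 M, (N <= M)%N & A * t ^+ M < e.
Proof.
case: A => A a; case: t => t b; case: e => e c.
rewrite !lecE !ltcE /= => /andP[/eqP -> A0] /andP[/eqP -> t0] /andP[_ t1] /andP[/eqP -> e0].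
have tn : `|t| < 1 by rewrite ger0_norm.
have A1 : 0 < A + 1 by rewrite ltr_wpDl.
have /cvgrPdist_lt /(_ _ (divr_gt0 e0 A1)) [n _ hn] := cvg_expr tn.
exists (maxn N n); first exact: leq_maxl.
have := hn (maxn N n) (leq_maxr _ _); rewrite /= sub0r normrN ger0_norm ?exprn_ge0 //.
rewrite ltr_pdivlMr // => h.
rewrite -[(A +i* _)%C]/(A%:C%C) -[(t +i* _)%C]/(t%:C%C) -[(e +i* _)%C]/(e%:C%C).
rewrite -rmorphXn -rmorphM ltcR.
apply: le_lt_trans h; rewrite mulrC ler_wpM2l ?exprn_ge0 //.
by rewrite lerDl.
Qed.

End Complex.

Theorem theorem1p3 (R : realType) (N k : nat) (N_ge1 : (1 <= N)%N)
  (k_ge1 : (1 <= k)%N)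
  (x r : 'I_N -> R[i]) (w theta : 'I_k -> R[i]) (y s : nat -> R[i])
  (* no denominator vanishes *)
  (r_neq0 : forall i, r i != 0) (theta_neq0 : forall j, theta j != 0)
  (s_neq0 : forall p, s p != 0)
  (sy_neq_x : forall p i, s p ^- 2 * y p - x i != 0)
  (y_neq_x : forall p i, y p - x i != 0)
  (sy_neq_w : forall p j, s p ^- 2 * y p - w j != 0)
  (* a denominator attached to a repeated variable stays away from 0 *)
  (y_far_x : forall i i', i != i' -> x i = x i' ->
     exists2 delta : R, 0 < delta & forall p, delta <= cabs (y p - x i))
  (sy_far_w : forall j j', j != j' -> w j = w j' ->
     exists2 delta : R, 0 < delta &
       forall p, delta <= cabs (s p ^- 2 * y p - w j))
  (sup_lt1 : forall (i : 'I_N) (j : 'I_k),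
     (ereal_sup (range (fun p : nat =>
        (cabs ((s p ^- 2 * y p - x i) / (y p - x i) *
               ((y p - w j) / (s p ^- 2 * y p - w j))))%:E)) < 1%:E)%E) :
  has_sum (fun lam : signature N => G lam w y theta s * F lam x y r s)
    ((\prod_(i < N) \prod_(j < N | (i <= j)%N) (r i ^- 2 * x i - x j)) *
     (\prod_(i < N) \prod_(j < N | (i < j)%N) (s i ^- 2 * y i - y j)) /
     (\prod_(i < N) \prod_(j < N) (y i - x j)) *
     \prod_(i < N) \prod_(j < k)
        ((x i - theta j ^- 2 * w j) / (x i - w j))).
Proof.
have [dx dx0 hx] := separated y_far_x.
have [dw dw0 hw] := separated sy_far_w.
have [d d0 [ddx ddw]] : exists2 d, 0 < d & d <= dx /\ d <= dw.
  have [||e e0 he] := @uniform_pos R[i] bool (fun b e => e <= if b then dx else dw).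
  - by move=> b; exists (if b then dx else dw) => //; case: b.
  - by move=> b e e' /le_trans; apply.
  by exists e => //; split; [exact: (he true)|exact: (he false)].
pose ratio p i j := (s p ^- 2 * y p - x i) / (y p - x i) *
  ((y p - w j) / (s p ^- 2 * y p - w j)).
have [e e0 he] : exists2 e : R[i], 0 < e & forall p i j, `|ratio p i j| <= 1 - e.
  have [||e e0 he] := @uniform_pos R[i] ('I_N * 'I_k)%type
    (fun ij e => forall p, `|ratio p ij.1 ij.2| <= 1 - e).
  - move=> [i j] /=; have := sup_lt1 i j; set S := ereal_sup _ => S1.
    have ub p : ((cabs (ratio p i j))%:E <= S)%E by apply: ereal_sup_ubound; exists p.
    case: S S1 ub => [u|//|] S1 ub; last by have := ub 0%N.
    exists (1 - u)%:C%C => [|p]; first by rewrite ltcR subr_gt0 -lte_fin.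
    by rewrite normC_cabs -[1 in leRHS]/(1%:C%C) -rmorphB opprB addrC subrK lecR -lee_fin.
  - by move=> [i j] u u' uu h p; apply: le_trans (h p) _; rewrite lerD2l lerN2.
  by exists e => // p i j; exact: (he (i, j)).
have xw i j : x i != w j.
  apply/eqP => xiwj; have := he 0%N i j; rewrite /ratio -xiwj mulrA mulfVK //.
  by rewrite divff // normr1 lerDl oppr_ge0 => /(lt_le_trans e0); rewrite ltxx.
have rho0 : 0 <= 1 - e by apply: le_trans (he 0%N (Ordinal N_ge1) (Ordinal k_ge1)).
have rho1 : 1 - e < 1 by rewrite ltrBlDr ltrDl.
have [A [t [A0 t0 t1 hA]]] := @cauchy_estimate R[i] N k x r w theta y s d (1 - e)
  N_ge1 k_ge1 d0 rho0 rho1 sy_neq_x sy_neq_w y_neq_x xw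
  (fun p i l il => match hx i l il p with or_introl h => or_introl (le_trans ddx h)
                                     | or_intror h => or_intror (le_trans ddx h) end)
  (fun p i l il => match hw i l il p with or_introl h => or_introl (le_trans ddw h)
                                     | or_intror h => or_intror (le_trans ddw h) end)
  he.
rewrite /has_sum -/(cauchy_value x r w theta y s).
have FF : Filter (@summability.totally (signature N)) by have [] := @summability.totally_filter (signature N).
apply/cvgrPdist_lt => eps eps0.
have [M NM hM] := exp_small N A0 t0 t1 eps0.
exists (bounded_signatures N M) => // J /= sub.
rewrite distrC; apply: le_lt_trans hM; apply: le_trans (hA M J NM sub).
by rewrite /summability.partial_sum big_seq_fsetE.
Qed.
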